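(* Let $N\ge 1$ and $e\ge 1$ be integers and let $d_1,\dots,d_N$ be non-negative integers. For a family $I=\{a_1,\dots,a_l\}$ of labeled degrees write $T_M(n;n_1,\dots,n_k,I)=T_M(n;n_1,\dots,n_k,a_1,\dots,a_l)$. Then $$T_N(e; d_1, \dotsc, d_N) = \sum_{\substack{e_1 + e_2 = e-1\\ e_1,e_2\ge 0}} \biggl( \sum_{\substack{ I \cup J = \{ d_2, \dotsc, d_N\}\\ I\cap J=\emptyset }} T_{|I|+1}(e_1; d_1-1, I)\, T_{|J|+1}(e_2; J) + \sum_{r=2}^N\ \sum_{\substack{I \cup J = \{d_2, \dotsc, \hat d_r, \dotsc, d_N\} \\ I\cap J=\emptyset}} d_r \, T_{|I|+1}(e_1; d_1-1, I)\, T_{|J|+1}(e_2; d_r-1, J) \biggr).$$ Here $|S|$ is the number of elements of $S$, a hat means that the element is omitted, and the inner sums run over all ordered pairs $(I,J)$ of (possibly empty) disjoint sets whose union is the indicated set, where $d_2,\dots,d_N$ are regarded as distinct labels (indexed by $2,\dots,N$) and not as integers, so that even if $d_i=d_j$, a partition with $d_i\in I$, $d_j\in J$ is different from one with $d_j\in I$, $d_i\in J$.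
   Context: A plane tree with $e\ge1$ edges is a triple $\Gamma=(H,\alpha,\sigma)$, where $H$ is a set of $2e$ half-edges and $\alpha,\sigma$ are permutations of $H$ such that $\alpha$ is a fixed-point-free involution, the group generated by $\alpha,\sigma$ acts transitively on $H$, and $\sigma$ has exactly $e+1$ cycles (fixed points counted as cycles). Cycles of $\alpha$ are the edges, cycles of $\sigma$ are the vertices (with the cyclic order of half-edges around them), and the degree of a vertex is the length of its cycle. An $N$-rooted tree ($N\ge1$) is a plane tree together with $N$ distinct half-edges (roots) belonging to $N$ distinct cycles of $\sigma$; the corresponding $N$ vertices (root vertices) are labeled $v_1,\dots,v_N$. An isomorphism of $N$-rooted trees $(H,\alpha,\sigma)\to(H',\alpha',\sigma')$ is a bijection $\varphi:H\to H'$ with $\alpha=\varphi^{-1}\alpha'\varphi$, $\sigma=\varphi^{-1}\sigma'\varphi$, sending the $k$th root to the $k$th root for all $k$. Isomorphic trees are identified. As an exceptional case, the graph with one vertex (of degree $0$) and no edges counts as a one-rooted tree with $e=0$, and it is the only $N$-rooted tree with $e=0$. $T_N(e;d_1,\dots,d_k)$, $0\le k\le N$, is the number of $N$-rooted trees with $e$ edges in which the root vertex $v_j$ has degree $d_j$ for $j=1,\dots,k$ (the degrees of the other root vertices are unconstrained); $T_N(e)$ is the case $k=0$. In particular $T_1(0)=T_1(0;0)=1$. The number is $0$ whenever no such tree exists (in particular for negative arguments). *)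

(* Defs.v *)
From HB Require Import structures.
From mathcomp Require Import all_boot all_order all_algebra all_fingroup.

Set Implicit Arguments.
Unset Strict Implicit.
Unset Printing Implicit Defensive.

Import GRing.Theory.

Section RootedTrees.

Variables (H : finType) (N : nat).

Definition is_plane_tree (e : nat) (alpha sigma : {perm H}) : bool :=
  [&& #|H| == e.*2,
      [forall h, (alpha h != h) && (alpha (alpha h) == h)],
      [transitive <<[set alpha; sigma]>>%g, on [set: H] | 'P]
    & #|porbits sigma| == e.+1].

(* ((alpha, sigma), roots) *)
Definition rooted_map : finType := ({perm H} * {perm H} * N.-tuple H)%type.

Definition rm_alpha (t : rooted_map) : {perm H} := t.1.1.
Definition rm_sigma (t : rooted_map) : {perm H} := t.1.2.
Definition rm_roots (t : rooted_map) : N.-tuple H := t.2.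

(* The roots are required to lie on distinct cycles of sigma, which makes them
   distinct. *)
Definition is_rooted_tree (e : nat) (t : rooted_map) : bool :=
  is_plane_tree e (rm_alpha t) (rm_sigma t) &&
  uniq [seq porbit (rm_sigma t) h | h <- rm_roots t].

(* Products of permutations compose from left to right, so phi * a * phi^-1
   is the map h |-> phi^-1 (a (phi h)). *)
Definition rooted_iso (t t' : rooted_map) : bool :=
  [exists phi : {perm H},
    [&& rm_alpha t == (phi * rm_alpha t' * phi^-1)%g,
        rm_sigma t == (phi * rm_sigma t' * phi^-1)%g
      & [forall k : 'I_N, phi (tnth (rm_roots t) k) == tnth (rm_roots t') k]]].

Definition root_degrees (t : rooted_map) : seq int :=
  [seq Posz #|porbit (rm_sigma t) h| | h <- rm_roots t].

End RootedTrees.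

(* T N e [:: d_1; ...; d_k] is T_N(e; d_1, ..., d_k). For e > 0, a set of 2e
   half-edges can be taken to be 'I_(2e) up to isomorphism, and T counts the
   isomorphism classes. For e = 0 there is only the one-vertex tree, which has
   one root vertex, of degree 0. The prescribed degrees are integers
   so that T vanishes on a degree d - 1 with d = 0. *)
Definition T (N e : nat) (ds : seq int) : nat :=
  if e is 0 then nat_of_bool ((N == 1) && prefix ds [:: Posz 0])
  else #|equivalence_partition (@rooted_iso 'I_(e.*2) N)
           [set t : rooted_map 'I_(e.*2) N |
              is_rooted_tree e t && prefix ds (root_degrees t)]|.

Lemma rooted_iso_equiv (H : finType) (N : nat) :
  equivalence_rel (@rooted_iso H N).
Proof.
have R t : @rooted_iso H N t t.
  apply/existsP; exists 1%g; rewrite invg1 !mul1g !mulg1 !eqxx /=.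
  by apply/forallP => k; rewrite perm1.
have S t t' : @rooted_iso H N t t' -> rooted_iso t' t.
  case/existsP=> p /and3P[/eqP ha /eqP hs /forallP hr]; apply/existsP.
  exists p^-1%g; rewrite ha hs invgK !mulgA mulVg !mul1g -!mulgA mulVg !mulg1.
  rewrite !eqxx /=; apply/forallP => k.
  by rewrite -(eqP (hr k)) permK.
have Tr t t' t'' : @rooted_iso H N t t' -> rooted_iso t' t'' -> rooted_iso t t''.
  case/existsP=> p /and3P[/eqP ha /eqP hs /forallP hr].
  case/existsP=> q /and3P[/eqP ka /eqP ks /forallP kr].
  apply/existsP; exists (p * q)%g.
  rewrite ha hs ka ks invMg !mulgA !eqxx /=; apply/forallP => k.
  by rewrite permM (eqP (hr k)).
move=> x y z; split=> [|xy]; first exact: R.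
by apply/idP/idP; [apply: Tr (S _ _ xy) | apply: Tr xy].
Qed.

(* Main.v *)
Require Import Defs.
From mathcomp Require Import all_boot all_order all_algebra all_fingroup.
From mathcomp Require Import zify.

Set Implicit Arguments.
Unset Strict Implicit.
Unset Printing Implicit Defensive.

(** Count labelled trees and cut the edge that carries the first root.

    A root kills all automorphisms, since a relabelling that commutes with
    alpha and sigma and fixes one half-edge fixes its whole orbit, which is
    everything.  Hence (2e)! T_N(e; ...) is the number of rooted trees on a
    fixed set of 2e half-edges ([card_labelled]).

    Let a be the first root, at v_1, and b = alpha a.  Turning a and b into
    fixed points of alpha, with sigma unchanged, separates a tree into the
    component A of a and its complement, which contains b
    ([cutP], [glueP], [sum_trees_cut]).  Each part is a planted tree: a tree
    with one half-edge, the leg, that is fixed by alpha.  Two parts come out,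
    each with the right number of vertices, because a connected map with c
    vertices, e edges and f fixed half-edges satisfies c <= e + 1, that is
    2c + f <= 2e + f + 2 ([leq_ncycles_component]); the number of vertices of
    the original tree leaves no slack.

    Deleting the leg of a planted tree gives a tree with one half-edge less at
    the root vertex, rooted at the half-edge that follows the leg; this inverts
    the insertion of a new half-edge in the corner of a root
    ([sum_trees_plant], [sum_planted_rooted]).  A planted tree on 2n + 1
    half-edges whose leg lies at a vertex of degree m thus corresponds to a
    tree with n edges and root vertex of degree m - 1.  The bare leg is the
    planted form of the tree without edges, so that this tree needs no separate
    treatment when a tree is cut.

    The remaining roots split according to where they lie: I in A, J in the
    complement of A but away from the vertex of b, and at most one root r at
    the vertex of b ([root_choices_split]).  The vertex of b is then either
    an extra root vertex of unconstrained degree, or v_r, on which the root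
    can be any of d_r half-edges; this is the origin of the two inner sums and
    of the factor d_r ([sum_glued]).

    Finally the choices of A with 2 e1 + 1 elements, of a in A and of b outside
    A number C(2e, 2 e1 + 1) (2 e1 + 1) (2 e2 + 1), where e1 + e2 = e - 1.
    Multiplied by (2 e1)! (2 e2)!, from the labelled counts of the two parts,
    this is (2e)!, which cancels ([T_cut]). *)

(** * Orbits and the bound on the number of vertices *)
Section Orbits.
Variable H : finType.
Implicit Types (al si s u : {perm H}) (A C : {set H}) (a x y : H).

Lemma astabs_permP s C :
  reflect (forall x, x \in C -> s x \in C) (s \in 'N(C | 'P)%g).
Proof.
apply: (iffP idP) => [sC x xC | sC]; first by move: (astabs_act x sC) => /= ->.
by rewrite !inE; apply/subsetP=> x xC; rewrite inE; apply: sC.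
Qed.

Lemma astabs_permE s C x : s \in 'N(C | 'P)%g -> (s x \in C) = (x \in C).
Proof. by move/astabs_act=> /(_ x). Qed.

Lemma perm_on_astabs s C : perm_on C s -> s \in 'N(C | 'P)%g.
Proof. by move=> sC; apply/astabs_permP=> x; rewrite perm_closed. Qed.

Lemma porbit_sub s C x : s \in 'N(C | 'P)%g -> x \in C -> porbit s x \subset C.
Proof.
move=> sC xC; apply/subsetP=> _ /porbitP[i ->].
by rewrite astabs_permE // groupX.
Qed.

Lemma porbit_astabs s x : s \in 'N(porbit s x | 'P)%g.
Proof.
apply/astabs_permP=> _ /porbitP[i ->]; rewrite -permM -expgSr.
exact: mem_porbit.
Qed.

Lemma imset_porbit s x : porbit s @: porbit s x = [set porbit s x].
Proof.
apply/setP=> X; rewrite inE; apply/imsetP/eqP=> [[y yo ->] | ->].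
  by apply/eqP; rewrite eq_porbit_mem.
by exists x; rewrite ?porbit_id.
Qed.

Lemma eq_in_porbit s u C x : s \in 'N(C | 'P)%g -> {in C, s =1 u} -> x \in C ->
  porbit s x = porbit u x.
Proof.
move=> sC su xC.
have sE i : ((s ^+ i) x = (u ^+ i) x)%g.
  elim: i => [|i IHi]; first by rewrite !expg0.
  by rewrite !expgSr !permM -IHi su // astabs_permE // groupX.
by apply/setP=> y; apply/porbitP/porbitP=> -[i ->]; exists i; rewrite sE.
Qed.

Definition ncycles s A := #|porbit s @: A|.

Lemma eq_in_ncycles s u C : s \in 'N(C | 'P)%g -> {in C, s =1 u} ->
  ncycles s C = ncycles u C.
Proof.
move=> sC su; congr #|pred_of_set _|.
by apply: eq_in_imset => x; apply: eq_in_porbit sC su.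
Qed.

Definition component al si a : {set H} := orbit 'P <<[set al; si]>>%g a.

Lemma component_id al si a : a \in component al si a.
Proof. exact: orbit_refl. Qed.

Lemma component_sub al si a C : al \in 'N(C | 'P)%g -> si \in 'N(C | 'P)%g ->
  a \in C -> component al si a \subset C.
Proof.
move=> alC siC aC; rewrite /component acts_sub_orbit //.
by rewrite gen_subG; apply/subsetP=> s; rewrite in_set2 => /orP[]/eqP->.
Qed.

(** Together with [component_sub], this makes the component of a the smallest
    stable set that contains a, which is how connectedness is used below. *)
Lemma component_astabs al si a :
  (al \in 'N(component al si a | 'P)%g) * (si \in 'N(component al si a | 'P)%g).
Proof.
by split; apply/astabs_permP=> x; rewrite /component => xa;
  apply: etrans xa; apply: (@orbit_actr _ _ 'P%act);
  rewrite mem_gen // !inE eqxx ?orbT.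
Qed.

Lemma eq_in_component al si al' si' C a :
  al \in 'N(C | 'P)%g -> si \in 'N(C | 'P)%g ->
  {in C, al =1 al'} -> {in C, si =1 si'} -> a \in C ->
  component al si a = component al' si' a.
Proof.
move=> alC siC eal esi aC.
have al'C : al' \in 'N(C | 'P)%g.
  by apply/astabs_permP=> x xC; rewrite -eal // astabs_permE.
have si'C : si' \in 'N(C | 'P)%g.
  by apply/astabs_permP=> x xC; rewrite -esi // astabs_permE.
have subC := subsetP (component_sub alC siC aC).
have subC' := subsetP (component_sub al'C si'C aC).
have N1 := component_astabs al si a; have N2 := component_astabs al' si' a.
apply/eqP; rewrite eqEsubset; apply/andP; split; apply: component_sub;
  rewrite ?component_id //; apply/astabs_permP=> x xC.
- by rewrite eal ?(astabs_permE _ N2.1) // subC'.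
- by rewrite esi ?(astabs_permE _ N2.2) // subC'.
- by rewrite -eal ?(astabs_permE _ N1.1) // subC.
- by rewrite -esi ?(astabs_permE _ N1.2) // subC.
Qed.

(** The half-edges of the edges that have both ends in C. *)
Definition inner al C := [set h in C | (al h \in C) && (al h != h)].

(** A union C of vertices that contains a grows to the whole component one
    neighbouring vertex at a time.  A step adds one vertex and at least the
    edge that leads to it, so that an inequality c <= e + 1 between the numbers
    of vertices and inner edges persists. *)
Lemma ncycles_inner_grow al si a A C :
    involutive al -> component al si a = A -> a \in C -> C \subset A ->
    si \in 'N(C | 'P)%g -> (ncycles si C).*2 <= #|inner al C| + 2 ->
  (ncycles si A).*2 <= #|inner al A| + 2.
Proof.
move=> alI defA aC; have [n] := ubnP #|A :\: C|.
elim: n C aC => // n IHn C aC ltn CA siC leC.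
have [alC | /astabs_permP] := boolP (al \in 'N(C | 'P)%g).
  suff <- : C = A by [].
  by apply/eqP; rewrite eqEsubset CA -defA component_sub.
(* C is not stable under al: the edge of h leads to a new vertex. *)
move=> nC; have /exists_inP[h hC ahC] : [exists h in C, al h \notin C].
  by rewrite -negb_forall_in; apply/negP=> /forall_inP.
have hA : h \in A by apply: (subsetP CA).
have ahA : al h \in A.
  by move: hA; rewrite -defA (astabs_permE _ (component_astabs al si a).1).
have orbA : porbit si (al h) \subset A.
  by apply: porbit_sub ahA; rewrite -defA (component_astabs al si a).2.
apply: (IHn (C :|: porbit si (al h))).
- by rewrite inE aC.
- rewrite ltnS in ltn; apply: leq_trans ltn; apply/proper_card/properP; split.
    by apply: setDS; apply: subsetUl.
  by exists (al h); rewrite !inE ?ahA ?ahC // porbit_id orbT.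
- by rewrite subUset CA.
- apply/astabs_permP=> x; rewrite !inE astabs_permE //.
  by rewrite (astabs_permE x (porbit_astabs si (al h))).
rewrite /ncycles; have -> : porbit si @: (C :|: porbit si (al h))
    = porbit si (al h) |: porbit si @: C.
  by rewrite imsetU imset_porbit setUC.
apply: (@leq_trans ((ncycles si C).+1).*2).
  by rewrite leq_double cardsU1; case: (_ \notin _).
rewrite doubleS -addn2.
suff /subset_leq_card le2 :
  [set h; al h] :|: inner al C \subset inner al (C :|: porbit si (al h)).
  have dj : [disjoint [set h; al h] & inner al C].
    rewrite disjoint_sym disjoints_subset; apply/subsetP=> x; rewrite !inE.
    case/and3P=> xC axC _; apply/norP; split; apply/eqP=> ex.
      by rewrite -ex axC in ahC.
    by rewrite -ex xC in ahC.
  move: le2; rewrite cardsU (disjoint_setI0 dj) cards0 subn0 cards2.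
  have -> : h != al h by apply: contraNneq ahC => <-.
  move=> le2; lia.
apply/subsetP=> x; rewrite !inE => /orP[/orP[]/eqP-> | /and3P[-> -> ->] //].
  by rewrite hC porbit_id orbT /=; apply: contraNneq ahC => e; rewrite e.
rewrite alI hC porbit_id orbT /= eq_sym.
by apply: contraNneq ahC => e; rewrite e.
Qed.

(** A connected map with e edges has at most e + 1 vertices: a single vertex
    satisfies the inequality, and [ncycles_inner_grow] propagates it. *)
Lemma leq_ncycles_component al si a :
  let A := component al si a in involutive al ->
  (ncycles si A).*2 + #|[set h in A | al h == h]| <= #|A| + 2.
Proof.
move=> A alI; have N1 := component_astabs al si a.
have orbA : porbit si a \subset A.
  by apply: porbit_sub (component_id _ _ _); apply: N1.2.
have := @ncycles_inner_grow al si a A (porbit si a) alI erefl.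
rewrite porbit_id porbit_astabs orbA => /(_ isT isT isT).
rewrite {1}/ncycles imset_porbit cards1 addn2 => /(_ isT) le1.
rewrite -(cardsID [set h | al h == h] A).
have -> : A :&: [set h | al h == h] = [set h in A | al h == h].
  by apply/setP=> x; rewrite !inE.
suff -> : A :\: [set h | al h == h] = inner al A by lia.
apply/setP=> x; rewrite !inE (astabs_permE _ N1.1) -/A.
by rewrite andbC; case: (x \in A).
Qed.

End Orbits.

(** * Cutting a tree at an edge *)
Section Cut.
Variable H : finType.
Implicit Types (al si u : {perm H}) (A C F : {set H}) (a b x y : H).
Implicit Types (s p q : {perm H} * {perm H}).

(** F is the set of legs, the half-edges that belong to no edge.  A rooted tree
    has F = set0 and a planted tree has F = [set a].  With #|A| - #|F| twice the
    number of edges, the last condition says that there is one vertex more than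
    there are edges.  Both permutations are trivial outside A, so that a tree on
    A is a pair of permutations in exactly one way. *)
Definition is_tree A F x s :=
  [&& perm_on A s.1, perm_on A s.2, [forall h, s.1 (s.1 h) == h],
      [set h in A | s.1 h == h] == F, component s.1 s.2 x == A
    & (ncycles s.2 A).*2 + #|F| == #|A| + 2].

Lemma is_treeP A F x s :
  reflect [/\ perm_on A s.1, perm_on A s.2 & [/\ involutive s.1,
              [set h in A | s.1 h == h] = F, component s.1 s.2 x = A
            & (ncycles s.2 A).*2 + #|F| = #|A| + 2]]
          (is_tree A F x s).
Proof.
apply: (iffP and5P) => [[-> -> /forallP I /eqP-> /andP[/eqP-> /eqP->]] | ].
  by split=> //; split=> // h; apply/eqP.
case=> -> -> [I -> -> ->]; split=> //; last by rewrite !eqxx.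
by apply/forallP=> h; rewrite I.
Qed.

Lemma eq_restr_perm A u si : perm_on A u -> si \in 'N(A | 'P)%g ->
  {in A, si =1 u} -> restr_perm A si = u.
Proof.
move=> uA siA e; apply/permP=> x; have [xA | nxA] := boolP (x \in A).
  by rewrite restr_permE // e.
by rewrite (out_perm (restr_perm_on A si)) // (out_perm uA).
Qed.

Lemma tperm_astabs C a b : a \in C -> b \in C -> tperm a b \in 'N(C | 'P)%g.
Proof. by move=> aC bC; apply/astabs_permP=> x xC; case: tpermP. Qed.

Lemma ncyclesC A si : si \in 'N(A | 'P)%g ->
  ncycles si setT = ncycles si A + ncycles si (~: A).
Proof.
move=> siA; rewrite /ncycles -(setUCr A) imsetU cardsU.
suff -> : (porbit si @: A) :&: (porbit si @: (~: A)) = set0.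
  by rewrite cards0 subn0.
apply/setP=> X; rewrite !inE; apply/andP=> -[/imsetP[x xA ->] /imsetP[y]].
rewrite inE => yA /eqP; rewrite eq_porbit_mem => xy; case/negP: yA.
have := subsetP (porbit_sub siA xA) y; rewrite porbit_sym; exact.
Qed.

Definition glue a b p q : {perm H} * {perm H} :=
  (p.1 * q.1 * tperm a b, p.2 * q.2)%g.

Definition cut a b A s : {perm H} * {perm H} :=
  (restr_perm A (s.1 * tperm a b), restr_perm A s.2)%g.

(** If b stayed in the component of a, this component would be everything, and
    the map would keep all its vertices with one edge less, against
    [leq_ncycles_component].  So there are two components, and the sum of
    the two bounds is the exact number of vertices of s: both are equalities. *)
Lemma cutP a b A s : is_tree setT set0 a s -> s.1 a = b ->
    component (s.1 * tperm a b)%g s.2 a = A ->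
  [/\ is_tree A [set a] a (cut a b A s),
      is_tree (~: A) [set b] b (cut a b (~: A) s),
      glue a b (cut a b A s) (cut a b (~: A) s) = s & b \notin A].
Proof.
case: s => al si /is_treeP[/= _ _ [alI fix0 alT cT]] alab.
have alba : al b = a by rewrite -alab alI.
have alN h : al h != h.
  by apply/negP=> e; move/setP: fix0 => /(_ h); rewrite !inE e.
have neab : a != b by rewrite eq_sym -alab.
set al' := (al * tperm a b)%g => defA.
have al'a : al' a = a by rewrite permM alab tpermR.
have al'b : al' b = b by rewrite permM alba tpermL.
have alE : (al = al' * tperm a b)%g by rewrite -mulgA tperm2 mulg1.
have al'E h : h != a -> h != b -> al' h = al h.
  move=> ha hb; rewrite permM tpermD // eq_sym.
    by rewrite -alba (inj_eq perm_inj).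
  by rewrite -alab (inj_eq perm_inj).
have al'I : involutive al'.
  move=> h; have [->|ha] := eqVneq h a; first by rewrite !al'a.
  have [->|hb] := eqVneq h b; first by rewrite !al'b.
  rewrite (al'E h) // al'E ?alI //.
    by rewrite -alba (inj_eq perm_inj).
  by rewrite -alab (inj_eq perm_inj).
have fix_al' h : (al' h == h) = (h \in [set a; b]).
  rewrite !inE; have [->|ha] := eqVneq h a; first by rewrite al'a eqxx.
  have [->|hb] := eqVneq h b; first by rewrite al'b eqxx.
  by rewrite al'E // (negbTE (alN h)).
have N := component_astabs al' si a; rewrite defA in N.
have aA : a \in A by rewrite -defA component_id.
(* A stable set that contains both a and b is stable under al as well. *)
have full C : al' \in 'N(C | 'P)%g -> si \in 'N(C | 'P)%g -> a \in C -> b \in C ->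
    C = setT.
  move=> al'C siC aC bC; apply/eqP; rewrite -subTset -alT component_sub //.
  by rewrite alE groupM ?tperm_astabs.
have bA : b \notin A.
  apply/negP=> bA; have AT : A = setT by apply: full; rewrite ?N.
  have := leq_ncycles_component si a al'I; rewrite defA AT.
  have -> : [set h in [set: H] | al' h == h] = [set a; b].
    by apply/setP=> h; rewrite !inE fix_al' !inE.
  rewrite cards2 neab; rewrite cards0 addn0 in cT; rewrite cT /=; lia.
(* The union of the two components contains a and b, hence is everything. *)
set B := component al' si b; have NB : _ * _ := component_astabs al' si b.
have bB : b \in B by rewrite component_id.
have BE : B = ~: A.
  have disj : B \subset ~: A.
    by apply: component_sub; rewrite ?astabsC ?N // inE.
  apply/eqP; rewrite eqEsubset disj -setTD subDset subTset /=; apply/eqP.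
  have [aAB bAB] : a \in A :|: B /\ b \in A :|: B by rewrite !inE aA bB orbT.
  apply: full => //; apply/astabs_permP=> x.
    by rewrite !inE (astabs_permE _ N.1) (astabs_permE _ NB.1).
  by rewrite !inE (astabs_permE _ N.2) (astabs_permE _ NB.2).
rewrite -/B BE in NB bB.
have fixA : [set h in A | al' h == h] = [set a].
  apply/setP=> h; rewrite !inE fix_al' !inE.
  have [->|ha] := eqVneq h a; first by rewrite aA.
  by have [->|hb] := eqVneq h b; rewrite ?(negbTE bA) ?andbF.
have fixB : [set h in ~: A | al' h == h] = [set b].
  apply/setP=> h; rewrite in_set in_setC fix_al' !inE.
  have [->|ha] := eqVneq h a; first by rewrite aA (negbTE neab).
  by have [->|hb] := eqVneq h b; rewrite ?(bA) ?andbF.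
have leA := leq_ncycles_component si a al'I; rewrite defA fixA cards1 in leA.
have leB := leq_ncycles_component si b al'I; rewrite -/B BE fixB cards1 in leB.
rewrite cards0 addn0 (ncyclesC N.2) cardsT in cT.
have cA : #|A| + #|~: A| = #|H| by apply: cardsC.
have rA u : u \in 'N(A | 'P)%g -> {in A, u =1 restr_perm A u}.
  by move=> uA x xA; rewrite restr_permE.
have rB u : u \in 'N(A | 'P)%g -> {in ~: A, u =1 restr_perm (~: A) u}.
  by move=> uA x xA; rewrite restr_permE ?astabsC.
have invol C : al' \in 'N(C | 'P)%g -> involutive (restr_perm C al').
  move=> al'C h; have [hC | nhC] := boolP (h \in C).
    by rewrite !(restr_permE al'C) ?astabs_permE // al'I.
  by rewrite !(out_perm (restr_perm_on C al')).
split=> //.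
- apply/is_treeP; rewrite !restr_perm_on -/al' -(eq_in_ncycles N.2 (rA _ N.2)).
  split=> //; split.
  + by apply: invol; rewrite N.
  + rewrite -fixA; apply/setP=> h; rewrite in_set [RHS]in_set.
    by case: (boolP (h \in A)) => //= hA; rewrite restr_permE ?N.
  + by rewrite -(eq_in_component N.1 N.2 (rA _ N.1) (rA _ N.2)).
  + rewrite cards1; lia.
- apply/is_treeP; rewrite !restr_perm_on -/al' -(eq_in_ncycles NB.2 (rB _ N.2)).
  split=> //; split.
  + by apply: invol; rewrite NB.
  + rewrite -fixB; apply/setP=> h; rewrite in_set [RHS]in_set.
    by case: (boolP (h \in ~: A)) => // hA; rewrite restr_permE ?NB.
  + by rewrite -(eq_in_component NB.1 NB.2 (rB _ N.1) (rB _ N.2)).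
  + rewrite cards1; lia.
have mulE u : u \in 'N(A | 'P)%g -> (restr_perm A u * restr_perm (~: A) u = u)%g.
  move=> uA; apply/permP=> x; rewrite permM.
  have [xA | nxA] := boolP (x \in A).
    rewrite (out_perm (restr_perm_on (~: A) u)) ?restr_permE //.
    by rewrite inE astabs_permE // xA.
  by rewrite (out_perm (restr_perm_on A u)) // restr_permE ?astabsC // inE.
by rewrite /glue /cut /= !mulE ?N // -mulgA tperm2 mulg1.
Qed.

(** Since [tperm a b] commutes with the product of the two involutions, gluing
    and cutting are inverse to each other.  Connectedness of the result comes
    from b = al a, and the vertex count from the additivity of [ncycles]. *)
Lemma glueP a b A p q : a \in A -> b \notin A ->
    is_tree A [set a] a p -> is_tree (~: A) [set b] b q ->
  let s := glue a b p q in
  [/\ is_tree setT set0 a s, s.1 a = b & component (s.1 * tperm a b)%g s.2 a = A] /\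
  [/\ s.2 \in 'N(A | 'P)%g, {in A, s.2 =1 p.2}, {in ~: A, s.2 =1 q.2},
      cut a b A s = p & cut a b (~: A) s = q].
Proof.
move=> aA bA; case: p => pa ps /is_treeP[/= paA psA [paI pfix pA pc]].
case: q => qa qs /is_treeP[/= qaB qsB [qaI qfix qB qc]] /=.
have neab : a != b by apply: contraNneq bA => <-.
have bB : b \in ~: A by rewrite inE.
have NA u u' : perm_on A u -> perm_on (~: A) u' ->
    [/\ {in A, (u * u')%g =1 u}, {in ~: A, (u * u')%g =1 u'} &
      (u * u' \in 'N(A | 'P))%g].
  move=> uA uB; have e1 : {in A, (u * u')%g =1 u}.
    by move=> x xA; rewrite permM (out_perm uB) // inE perm_closed // xA.
  split=> // [x | ]; first by rewrite inE permM => xA; rewrite (out_perm uA).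
  by apply/astabs_permP=> x xA; rewrite e1 ?perm_closed.
set u := (pa * qa)%g; set si := (ps * qs)%g.
have [uA uB uN] := NA _ _ paA qaB; have [sA sB sN] := NA _ _ psA qsB.
rewrite -/u in uA uB uN; rewrite -/si in sA sB sN.
have ua : u a = a.
  rewrite uA //; apply/eqP; move/setP: pfix => /(_ a).
  by rewrite !inE eqxx aA.
have ub : u b = b.
  rewrite uB //; apply/eqP; move/setP: qfix => /(_ b).
  by rewrite in_set bB inE eqxx.
have uI : involutive u.
  move=> x; have [xA | nxA] := boolP (x \in A).
    by rewrite !uA ?perm_closed // paI.
  have xB : x \in ~: A by rewrite inE.
  by rewrite !uB ?(perm_closed _ qaB) // qaI.
have fixu x : (u x == x) = (x == a) || (x == b).
  have [xA | nxA] := boolP (x \in A).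
    move/setP: pfix => /(_ x); rewrite uA // !inE xA /= => ->.
    have [e|_] := eqVneq x b; last by rewrite orbF.
    by rewrite -e xA in bA.
  have xB : x \in ~: A by rewrite inE.
  move/setP: qfix => /(_ x); rewrite uB // in_set xB inE /= => ->.
  have [e|_] := eqVneq x a; last by [].
  by rewrite e aA in nxA.
have uNB : u \in 'N(~: A | 'P)%g by rewrite astabsC.
have sNB : si \in 'N(~: A | 'P)%g by rewrite astabsC.
set al := (u * tperm a b)%g.
have alu : (al * tperm a b)%g = u by rewrite -mulgA tperm2 mulg1.
have ala : al a = b by rewrite permM ua tpermL.
have alb : al b = a by rewrite permM ub tpermR.
have alE x : x != a -> x != b -> al x = u x.
  move=> xa xb; rewrite permM tpermD // eq_sym.
    by rewrite -ua (inj_eq perm_inj).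
  by rewrite -ub (inj_eq perm_inj).
have cA : component u si a = A.
  by rewrite -pA; apply: eq_in_component uN sN uA sA aA.
have cB : component u si b = ~: A.
  by rewrite -qB; apply: eq_in_component uNB sNB uB sB bB.
split; last first.
  rewrite /cut /= alu -/si; split=> //; congr (_, _); exact: eq_restr_perm.
rewrite alu -/si; split=> //.
apply/is_treeP; split; [exact/subsetP | exact/subsetP | split] => /=.
- move=> x; have [->|xa] := eqVneq x a; first by rewrite ala.
  have [->|xb] := eqVneq x b; first by rewrite alb.
  rewrite (alE x) // alE ?uI //.
    by rewrite -[a]ua (inj_eq perm_inj).
  by rewrite -[b]ub (inj_eq perm_inj).
- apply/setP=> x; rewrite !inE /=.
  have [->|xa] := eqVneq x a; first by rewrite ala eq_sym (negbTE neab).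
  have [->|xb] := eqVneq x b; first by rewrite alb (negbTE neab).
  by rewrite alE // fixu (negbTE xa) (negbTE xb).
- have N := component_astabs al si a.
  have aC := component_id al si a.
  have bC : b \in component al si a by rewrite -[X in X \in _]ala astabs_permE ?N.
  have uC : u \in 'N(component al si a | 'P)%g.
    by rewrite -alu groupM ?N ?tperm_astabs.
  apply/eqP; rewrite -subTset -(setUCr A) subUset -{1}cA -{1}cB.
  by rewrite !component_sub ?N.
rewrite (ncyclesC sN) (eq_in_ncycles sN sA) (eq_in_ncycles sNB sB).
rewrite cards0 cardsT -(cardsC A); rewrite !cards1 in pc qc; lia.
Qed.

Lemma sum_trees_cut a (G : {perm H} * {perm H} -> nat) :
  \sum_(s | is_tree setT set0 a s) G s =
  \sum_b \sum_(A : {set H} | (a \in A) && (b \notin A))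
    \sum_(p | is_tree A [set a] a p) \sum_(q | is_tree (~: A) [set b] b q)
      G (glue a b p q).
Proof.
rewrite (partition_big (fun s => s.1 a) predT) //=; apply: eq_bigr => b _.
pose cmp s := component (s.1 * tperm a b)%g s.2 a.
rewrite (partition_big cmp [pred A : {set H} | (a \in A) && (b \notin A)]) /=.
  apply: eq_bigr => A /andP[aA bA].
  rewrite (pair_big _ _ (fun p q => G (glue a b p q))) /=.
  rewrite (reindex_onto (fun pq => glue a b pq.1 pq.2)
                        (fun s => (cut a b A s, cut a b (~: A) s))) /=.
    apply: eq_bigl => -[p q] /=; apply/andP/andP=> [[] | [pT qT]].
      case/andP=> /andP[sT /eqP sa] /eqP sA.
      by case/eqP=> e1 e2; case: (cutP sT sa sA); rewrite e1 e2 => -> ->.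
    have [[sT sa sA] [_ _ _ -> ->]] := glueP aA bA pT qT.
    by rewrite sT sa /cmp sA !eqxx.
  by move=> s /andP[/andP[sT /eqP sa] /eqP sA]; case: (cutP sT sa sA).
move=> s /andP[sT /eqP sa]; case: (cutP sT sa (erefl (cmp s))) => _ _ _ ->.
by rewrite /cmp component_id.
Qed.

End Cut.

(** * Planting a tree in a corner *)
Section Plant.
Variable H : finType.
Implicit Types (al si u : {perm H}) (A C F : {set H}) (a b x y h : H).
Implicit Types (s p q : {perm H} * {perm H}).

Lemma porbit_fix si a : si a = a -> porbit si a = [set a].
Proof.
move=> sa; apply/eqP; rewrite eqEsubset sub1set porbit_id andbT.
apply: porbit_sub; rewrite ?set11 //; apply/astabs_permP=> x.
by rewrite !inE => /eqP->; rewrite sa.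
Qed.

(** Composing with [tperm a x] inserts the fixed point a just before x in the
    cycle of x. *)
Lemma porbit_insertD si a x h : si a = a -> x != a -> h != a ->
  porbit (si * tperm a x)%g h :\ a = porbit si h.
Proof.
move=> sa xa ha; set t := (si * tperm a x)%g.
have ta : t a = x by rewrite permM sa tpermL.
have sE : si = (t * tperm a x)%g by rewrite -mulgA tperm2 mulg1.
have aP : a \notin porbit si h.
  by rewrite porbit_sym porbit_fix // inE.
apply/eqP; rewrite eqEsubset; apply/andP; split.
  (* The orbit of h, enlarged by a exactly when it is the orbit of x. *)
  pose D := porbit si h :|: (if x \in porbit si h then [set a] else set0).
  have tD : porbit t h \subset D.
    apply: porbit_sub; last by rewrite inE porbit_id.
    apply/astabs_permP=> y; rewrite in_setU => /orP[yP | ].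
      have siP : si y \in porbit si h by rewrite astabs_permE ?porbit_astabs.
      rewrite permM; case: tpermP => [e | e | _ _]; last by rewrite inE siP.
        by rewrite e (negbTE aP) in siP.
      by rewrite /D -e siP !inE eqxx orbT.
    by rewrite /D; case: ifP => xP; rewrite !inE // => /eqP->; rewrite ta xP.
  apply/subsetP=> y; rewrite !inE => /andP[ya /(subsetP tD)]; rewrite inE => /orP[//|].
  by case: ifP; rewrite !inE // (negbTE ya).
apply: porbit_sub; last by rewrite !inE ha porbit_id.
apply/astabs_permP=> y; rewrite !inE => /andP[ya yP].
have sya : si y != a by rewrite -[a in _ != a]sa (inj_eq perm_inj).
rewrite sya /= sE permM; have tyP : t y \in porbit t h.
  by rewrite astabs_permE ?porbit_astabs.
case: tpermP => [e | e | //]; last first.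
  by rewrite sE permM e tpermR eqxx in sya.
by rewrite -ta -e !astabs_permE ?porbit_astabs.
Qed.

Lemma porbit_insert si a x : si a = a -> x != a ->
  porbit (si * tperm a x)%g a = a |: porbit si x.
Proof.
move=> sa xa; rewrite -(porbit_insertD sa xa xa).
have -> : porbit (si * tperm a x)%g x = porbit (si * tperm a x)%g a.
  apply/eqP; rewrite eq_porbit_mem; have := mem_porbit (si * tperm a x)%g 1 a.
  by rewrite expg1 permM sa tpermL.
by rewrite setD1K ?porbit_id.
Qed.

Lemma eq_porbit_insert si a x h h' : si a = a -> x != a -> h != a -> h' != a ->
  (porbit (si * tperm a x)%g h == porbit (si * tperm a x)%g h')
  = (porbit si h == porbit si h').
Proof.
move=> sa xa ha h'a; rewrite !eq_porbit_mem.
by rewrite -(porbit_insertD sa xa h'a) !inE ha.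
Qed.

Lemma ncycles_insert si a x C : si a = a -> a \notin C -> x \in C ->
  ncycles (si * tperm a x)%g (a |: C) = ncycles si C.
Proof.
move=> sa aC xC; have xa : x != a by apply: contraNneq aC => <-.
have CN h : h \in C -> h != a by move=> hC; apply: contraNneq aC => <-.
rewrite /ncycles imsetU imset_set1.
have -> : porbit (si * tperm a x)%g a = porbit (si * tperm a x)%g x.
  apply/eqP; rewrite eq_sym eq_porbit_mem porbit_insert // !inE porbit_id orbT //.
rewrite (setUidPr _); last by rewrite sub1set imset_f.
have -> : porbit si @: C = (fun X => X :\ a) @: (porbit (si * tperm a x)%g @: C).
  rewrite -imset_comp; apply: eq_in_imset => h hC /=.
  by rewrite porbit_insertD ?CN.
rewrite [RHS]card_in_imset // => _ _ /imsetP[h hC ->] /imsetP[h' h'C ->].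
rewrite !porbit_insertD ?CN // => /eqP e; apply/eqP.
by rewrite eq_porbit_insert ?CN.
Qed.

(** This map also deletes the half-edge a when x is the half-edge that follows
    a, which is why it is an involution. *)
Definition plant a x s : {perm H} * {perm H} := (s.1, s.2 * tperm a x)%g.

Lemma plantK a x : involutive (plant a x).
Proof. by case=> al si; rewrite /plant /= -mulgA tperm2 mulg1. Qed.

Lemma plant_tree a x C s : a \notin C -> x \in C -> is_tree C set0 x s ->
  is_tree (a |: C) [set a] a (plant a x s).
Proof.
case: s => al si aC xC /is_treeP[/= alC siC [alI fix0 comp cyc]].
have sub : C \subset a |: C by apply: subsetUr.
have siC' : perm_on (a |: C) (si * tperm a x)%g.
  apply: perm_onM; first exact: subset_trans siC sub.
  apply: subset_trans (tperm_on a x) _.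
  by rewrite subUset !sub1set !inE eqxx xC orbT.
have alC' : perm_on (a |: C) al by apply: subset_trans alC sub.
have sia : si a = a by rewrite (out_perm siC).
have tE : (si * tperm a x * tperm a x = si)%g by rewrite -mulgA tperm2 mulg1.
apply/is_treeP=> /=; split=> //; split=> //.
- apply/setP=> h; rewrite !inE; have [->|ha] := eqVneq h a.
    by rewrite (out_perm alC) // eqxx.
  by move/setP: fix0 => /(_ h); rewrite !inE.
- set t := (si * tperm a x)%g; have N := component_astabs al t a.
  apply/eqP; rewrite eqEsubset component_sub ?perm_on_astabs ?setU11 //=.
  have aD := component_id al t a.
  have xD : x \in component al t a.
    by have := astabs_permE a N.2; rewrite aD permM sia tpermL.
  rewrite subUset sub1set aD -{1}comp component_sub ?N //.
  by rewrite -tE groupM ?N ?tperm_astabs.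
by rewrite ncycles_insert // cardsU1 aC cards1; rewrite cards0 in cyc; lia.
Qed.

(** If C is nonempty then a is not alone at its vertex: otherwise the set with
    the single element a would be stable. *)
Lemma unplant_tree a C s : a \notin C -> C != set0 ->
    is_tree (a |: C) [set a] a s ->
  s.2 a \in C /\ is_tree C set0 (s.2 a) (plant a (s.2 a) s).
Proof.
case: s => al t aC C0 /is_treeP[/= alC tC [alI fixa comp cyc]].
have ala : al a = a.
  by move/setP: fixa => /(_ a); rewrite !inE eqxx /= => /eqP.
have xC : t a \in C.
  have : t a \in a |: C by rewrite perm_closed // !inE eqxx.
  rewrite !inE => /predU1P[e | //]; case/negP: C0.
  have /setP S : a |: C = [set a].
    apply/eqP; rewrite eqEsubset sub1set setU11 andbT -comp.
    by apply: component_sub; rewrite ?set11 //; apply/astabs_permP=> h;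
      rewrite !inE => /eqP->; rewrite ?ala ?e.
  apply/eqP/setP=> h; have := S h; rewrite !inE.
  by have [->|//] := eqVneq h a; rewrite (negbTE aC).
split=> //; move: xC; set x := t a => xC.
have xa : x != a by apply: contraNneq aC => <-.
set si := (t * tperm a x)%g.
have sia : si a = a by rewrite permM tpermR.
have tE : (si * tperm a x = t)%g by rewrite -mulgA tperm2 mulg1.
have onC u : perm_on (a |: C) u -> u a = a -> perm_on C u.
  move=> uC ua; apply/subsetP=> h; rewrite inE => hN.
  have := subsetP uC h; rewrite !inE => /(_ hN) /predU1P[e|//].
  by rewrite e ua eqxx in hN.
have siC : perm_on C si.
  apply: onC => //; apply: perm_onM => //.
  apply: subset_trans (tperm_on a x) _.
  by rewrite subUset !sub1set !inE eqxx xC orbT.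
have alC' := onC _ alC ala.
apply/is_treeP=> /=; split=> //; split=> //.
- apply/setP=> h; rewrite !inE; move/setP: fixa => /(_ h); rewrite !inE.
  have [->|_ /=] := eqVneq h a; last by [].
  by rewrite (negbTE aC).
- rewrite -/si; have N := component_astabs al si x.
  apply/eqP; rewrite eqEsubset component_sub ?perm_on_astabs //=.
  have : a |: C \subset a |: component al si x.
    rewrite -{1}comp; apply: component_sub; rewrite ?setU11 //.
      apply/astabs_permP=> h; rewrite !in_setU1 => /predU1P[-> | hD].
        by rewrite ala eqxx.
      by rewrite (astabs_permE _ N.1) hD orbT.
    rewrite -tE groupM //.
      apply/astabs_permP=> h; rewrite !in_setU1 => /predU1P[-> | hD].
        by rewrite sia eqxx.
      by rewrite (astabs_permE _ N.2) hD orbT.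
    by apply: tperm_astabs; rewrite !in_setU1 ?eqxx ?component_id ?orbT.
  move/subsetP=> sub; apply/subsetP=> h hC; have := sub h.
  rewrite !in_setU1 hC orbT => /(_ isT) /predU1P[e|//].
  by rewrite -e hC in aC.
rewrite -/si cards0 -(ncycles_insert sia aC xC) tE.
by rewrite cardsU1 aC cards1 in cyc; lia.
Qed.

Lemma sum_trees_plant a C (G : {perm H} * {perm H} -> nat) :
    a \notin C -> C != set0 ->
  \sum_(s | is_tree (a |: C) [set a] a s) G s =
  \sum_(x in C) \sum_(s | is_tree C set0 x s) G (plant a x s).
Proof.
move=> aC C0; rewrite (partition_big (fun s => s.2 a) (mem C)) /=; last first.
  by move=> s /(unplant_tree aC C0)[].
apply: eq_bigr => x xC.
rewrite (reindex_inj (inv_inj (plantK a x))) /=; apply: eq_bigl => s.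
apply/andP/idP => [[/(unplant_tree aC C0)[_ sT] /eqP sx] | sT].
  by rewrite -[s](plantK a x) -{1 2}sx.
rewrite plant_tree // permM; case/is_treeP: sT => _ siC _.
by rewrite (out_perm siC) // tpermL eqxx.
Qed.

End Plant.

(** * Placing the other roots *)
Section SplitSums.
Variables (L : finType).

Lemma sum_set_splits (K : {set L}) (F : {set L} -> {set L} -> nat) :
  \sum_(I : {set L}) \sum_(J : {set L} | (I :|: J == K) && (I :&: J == set0)) F I J
  = \sum_(I : {set L} | I \subset K) F I (K :\: I).
Proof.
rewrite [RHS]big_mkcond; apply: eq_bigr => I _; case: ifP => IK.
  rewrite (big_pred1 (K :\: I)) // => J; apply/andP/eqP => [[/eqP<- /eqP IJ] | ->].
    by rewrite setDUl setDv set0U; apply/esym/setDidPl; rewrite -setI_eq0 setIC IJ.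
  rewrite -{1}(setIidPr IK) setID eqxx; split=> //.
  by apply/eqP/setP=> i; rewrite !inE; case: (i \in I); rewrite ?andbF.
rewrite big1 // => J /andP[/eqP e _].
by rewrite -e subsetUl in IK.
Qed.

End SplitSums.

Section Roots.
Variable H : finType.
Implicit Types (al si u : {perm H}) (A C U : {set H}) (a b x y h : H).
Implicit Types (ds : seq nat) (s : seq H).

Definition good_roots si A a ds s :=
  [&& all (mem A) s, uniq [seq porbit si h | h <- a :: s]
    & [seq #|porbit si h| | h <- s] == ds].

(** The ways to complete the root a by roots of degrees ds on a given map. *)
Definition root_choices si A a ds : nat :=
  #|[set s : (size ds).-tuple H | good_roots si A a ds s]|.

Lemma eq_in_root_choices si u A a ds : si \in 'N(A | 'P)%g -> {in A, si =1 u} ->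
  a \in A -> root_choices si A a ds = root_choices u A a ds.
Proof.
move=> siA e aA; apply: eq_card => s; rewrite !inE /good_roots.
case: allP => // sA; congr [&& _, uniq _ & _ == ds].
  apply/eq_in_map => h; rewrite inE => /predU1P[-> | /sA];
    exact: (eq_in_porbit siA e).
by apply/eq_in_map => h /sA hA; rewrite (eq_in_porbit siA e).
Qed.

(** The inserted half-edge lies at the vertex of x, where no other root is
    allowed; the other vertices do not change. *)
Lemma root_choices_insert si C a x ds : perm_on C si -> a \notin C -> x \in C ->
  root_choices (si * tperm a x)%g (a |: C) a ds = root_choices si C x ds.
Proof.
move=> siC aC xC; apply: eq_card => s; rewrite !inE /good_roots /=.
have sa : si a = a by rewrite (out_perm siC).
have xa : x != a by apply: contraNneq aC => <-.
have CN h : h \in C -> h != a by move=> hC; apply: contraNneq aC => <-.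
set t := (si * tperm a x)%g.
have tax : porbit t a = porbit t x.
  by apply/eqP; rewrite eq_sym eq_porbit_mem porbit_insert // !inE porbit_id orbT.
have [sC | /allPn[h hs hC]] := boolP (all (mem C) s); last first.
  apply/negbTE/negP=> /andP[/allP sA /andP[/andP[/negP nin _] _]]; case: nin.
  have := sA h hs; rewrite /= in_setU1 => /predU1P[<- | hC']; last first.
    by rewrite /= hC' in hC.
  exact: map_f.
have -> : all (mem (a |: C)) s.
  by apply/allP=> h hs; apply: setU1r; apply: (allP sC).
have -> : (porbit t a \in [seq porbit t h | h <- s])
    = (porbit si x \in [seq porbit si h | h <- s]).
  apply/mapP/mapP=> -[h hs /eqP e]; exists h => //; apply/eqP; move: e;
    by rewrite tax eq_porbit_insert // CN //; apply: (allP sC).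
have sN h : h \in s -> h != a by move=> hs; apply: CN; apply: (allP sC).
rewrite /=; have [// | /= nin] := boolP (porbit si x \in _).
have e h : h \in s -> porbit t h = porbit si h.
  move=> hs; rewrite -(@porbit_insertD _ si a x) ?(sN h) //.
  apply/setP=> h'; rewrite !inE -/t; have [->|//] := eqVneq h' a.
  rewrite -eq_porbit_mem tax eq_porbit_insert ?(sN h) //=.
  by apply: contraNF nin => /eqP->; apply: map_f.
congr (uniq _ && (_ == ds)); first exact/eq_in_map.
by apply/eq_in_map => h /e ->.
Qed.

(** Passes from roots in sequence to roots indexed by a set of labels, which is
    the form that splits.  Functions take the default value y outside I. *)
Lemma card_ffun_tuple (L : finType) (I : {set L}) n y (Q : pred (seq H)) :
    n = #|I| ->
  #|[set f : {ffun L -> H} | [forall i, (i \notin I) ==> (f i == y)]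
                             && Q [seq f i | i <- enum I]]|
  = #|[set s : n.-tuple H | Q s]|.
Proof.
move=> ->; pose g (s : #|I|.-tuple H) := [ffun i => nth y s (index i (enum I))].
have gE (s : #|I|.-tuple H) : [seq g s i | i <- enum I] = s.
  apply: (@eq_from_nth _ y) => [|k]; first by rewrite size_map size_tuple -cardE.
  rewrite size_map -cardE => ltk.
  have x0 : L by case: (enum I) (cardE I) ltk => [|i _] //= ->.
  rewrite (nth_map x0) -?cardE // ffunE index_uniq ?enum_uniq -?cardE //.
have gI : injective g.
  by move=> s s' e; apply/val_inj; rewrite /= -[LHS]gE -[RHS]gE e.
rewrite -(card_imset _ gI); apply: eq_card => f; rewrite inE.
apply/andP/imsetP=> [[/forallP off Qf] | [s]].
  exists (map_tuple f (enum_tuple I)); first by rewrite inE.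
  apply/ffunP=> i; rewrite ffunE /=; have [iI | niI] := boolP (i \in I).
    by rewrite (nth_map i) ?index_mem ?nth_index ?mem_enum.
  have /implyP/(_ niI)/eqP-> := off i.
  by rewrite nth_default // size_map leqNgt index_mem mem_enum.
rewrite inE => Qs ->; rewrite gE; split=> //; apply/forallP=> i; apply/implyP=> niI.
by rewrite ffunE nth_default // size_tuple cardE leqNgt index_mem mem_enum.
Qed.

Section Placements.
Variables (L : finType) (d : L -> nat) (si : {perm H}) (y0 : H).
Implicit Types (I J K E : {set L}).

Definition degs I := [seq d i | i <- enum I].

Definition is_placement U I (f : {ffun L -> H}) :=
  [forall i, if i \in I then
      [&& f i \in U, #|porbit si (f i)| == d i
        & [forall (j | j \in I), (porbit si (f i) == porbit si (f j)) ==> (i == j)]]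
    else f i == y0].

Definition placements U I := [set f | is_placement U I f].

Lemma placementP U I (f : {ffun L -> H}) :
  reflect [/\ {in ~: I, forall i, f i = y0}, {in I, forall i, f i \in U},
              {in I, forall i, #|porbit si (f i)| = d i}
            & {in I &, forall i j, f j \in porbit si (f i) -> i = j}]
          (f \in placements U I).
Proof.
rewrite inE; apply: (iffP forallP) => [H0 | [off fU fd finj] i].
  split=> [i | i | i | i j] iI; have := H0 i.
  - by rewrite inE in iI; rewrite (negbTE iI) => /eqP.
  - by rewrite iI => /and3P[].
  - by rewrite iI => /and3P[_ /eqP].
  rewrite iI => /and3P[_ _ /forall_inP fj] jI; rewrite -eq_porbit_mem eq_sym.
  by move/(implyP (fj j jI))/eqP.
case: ifP => iI; last by rewrite off // inE iI.
rewrite fU // fd // eqxx /=; apply/forall_inP=> j jI; apply/implyP=> /eqP e.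
by rewrite (finj i j) // -eq_porbit_mem e.
Qed.

Lemma root_choices_placements A a I :
  root_choices si A a (degs I) = #|placements (A :\: porbit si a) I|.
Proof.
rewrite /root_choices -(@card_ffun_tuple L I _ y0); last by rewrite size_map -cardE.
apply: eq_card => f; rewrite inE; apply/idP/placementP.
  case/andP=> /forallP off /and3P[/allP fA /= /andP[fa fu] /eqP fd]; split=> i.
  - by rewrite inE => niI; apply/eqP; have := off i; rewrite niI.
  - move=> iI; have fin : f i \in [seq f i | i <- enum I].
      by apply: map_f; rewrite mem_enum.
    have := fA _ fin; rewrite /= inE => ->; rewrite andbT.
    rewrite -eq_porbit_mem; apply: contraNN fa => /eqP<-.
    by apply: map_f.
  - rewrite -map_comp in fd => iI.
    by have /eq_in_map := fd; apply; rewrite mem_enum.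
  - rewrite -map_comp in fu; have /dinjectiveP fj := fu.
    by move=> j iI jI; rewrite -eq_porbit_mem => /eqP e; apply: fj => //=.
case=> off fU fd fj; rewrite /good_roots /= -andbA; apply/and5P; split.
- by apply/forallP=> i; apply/implyP=> niI; rewrite off // inE.
- apply/allP=> _ /mapP[i iI ->]; rewrite mem_enum in iI.
  by have := fU i iI; rewrite inE => /andP[].
- apply/negP=> /mapP[_ /mapP[i iI ->] /eqP]; rewrite mem_enum in iI.
  by rewrite eq_sym eq_porbit_mem; have := fU i iI; rewrite inE => /andP[/negbTE->].
- rewrite -map_comp; apply/dinjectiveP=> i j iI jI /= e.
  by apply: fj => //; rewrite -eq_porbit_mem e.
- apply/eqP; rewrite -map_comp; apply/eq_in_map => i; rewrite mem_enum.
  exact: fd.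
Qed.

Definition restr I (f : {ffun L -> H}) : {ffun L -> H} :=
  [ffun i => if i \in I then f i else y0].

(** A placement in U :|: V is determined by the set I of the labels that land in
    U and by its restrictions to I and to K :\: I.  Conversely, two partial
    placements can be merged: roots on U and on V never share a vertex, because
    U is a union of vertices. *)
Lemma card_placementsU U (V : {set H}) K : si \in 'N(U | 'P)%g -> [disjoint U & V] ->
  #|placements (U :|: V) K|
  = \sum_(I : {set L} | I \subset K) #|placements U I| * #|placements V (K :\: I)|.
Proof.
move=> siU dUV.
have nV h : h \in U -> h \notin V by move=> hU; rewrite (disjointFr dUV).
pose inU (f : {ffun L -> H}) := [set i in K | f i \in U].
rewrite -sum1_card (partition_big inU (fun I : {set L} => I \subset K)) /=; last first.
  by move=> f _; apply/subsetP=> i; rewrite inE => /andP[].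
apply: eq_bigr => I IK; rewrite sum1_card -cardsX.
pose g (f : {ffun L -> H}) := (restr I f, restr (K :\: I) f).
have KI i : i \in I -> i \in K by apply: (subsetP IK).
rewrite -(@card_in_imset _ _ g); last first.
  move=> f f'; rewrite !unfold_in => /andP[/placementP[off _ _ _] _].
  case/andP=> /placementP[off' _ _ _] _ [/ffunP e1 /ffunP e2]; apply/ffunP=> i.
  have := e1 i; have := e2 i; rewrite !ffunE inE.
  have [iI // | iI] := boolP (i \in I); have [iK // | iK] := boolP (i \in K).
  by rewrite off ?off' // inE iK.
apply: eq_card => -[f1 f2]; rewrite in_setX /=.
apply/imsetP/andP=> [[f] | [/placementP[off1 f1U f1d f1j]]].
  rewrite unfold_in => /andP[/placementP[off fU fd fj] /eqP fI] [-> ->].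
  have IE i : (i \in I) = (i \in K) && (f i \in U) by rewrite -fI inE.
  split; apply/placementP; split=> i.
  - by rewrite inE ffunE => /negbTE->.
  - by move=> iI; rewrite ffunE iI; move: iI; rewrite IE => /andP[].
  - by move=> iI; rewrite ffunE iI fd ?KI.
  - by move=> j iI jI; rewrite !ffunE iI jI; apply: fj; apply: KI.
  - by rewrite inE ffunE => /negbTE->.
  - move=> iI; rewrite ffunE iI; move: iI; rewrite inE IE => /andP[niU iK].
    by have := fU i iK; rewrite iK /= in niU; rewrite inE (negbTE niU).
  - by move=> iI; rewrite ffunE iI fd //; case/setDP: iI.
  - move=> j iI jI; rewrite !ffunE iI jI; case/setDP: iI => iK _.
    by case/setDP: jI => jK _; apply: fj.
move=> /placementP[off2 f2V f2d f2j].
pose f : {ffun L -> H} := [ffun i => if i \in I then f1 i else f2 i].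
have fE1 i : i \in I -> f i = f1 i by rewrite ffunE => ->.
have fE2 i : i \notin I -> f i = f2 i by rewrite ffunE => /negbTE->.
have kd i : i \in K -> i \notin I -> i \in K :\: I by move=> iK iI; rewrite inE iI.
exists f; last first.
  congr (_, _); apply/ffunP=> i; rewrite ffunE; case: ifP => iI.
  - by rewrite fE1.
  - by rewrite off1 // inE iI.
  - by rewrite fE2 //; case/setDP: iI.
  - by rewrite off2 // inE iI.
have fUE i : i \in K -> (f i \in U) = (i \in I).
  move=> iK; have [iI | iI] := boolP (i \in I); first by rewrite fE1 ?f1U.
  by rewrite fE2 //; apply: contraTF (f2V i (kd i iK iI)) => /nV.
rewrite unfold_in; apply/andP; split; last first.
  apply/eqP/setP=> i; rewrite inE; have [iK | iK] := boolP (i \in K).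
    exact: fUE.
  by apply/esym/negP=> /KI; apply/negP.
apply/placementP; split=> i.
- rewrite inE => iK; rewrite fE2 ?off2 ?inE ?(negbTE iK) ?andbF //.
  by apply: contraNN iK => /KI.
- move=> iK; rewrite inE; have [iI | iI] := boolP (i \in I).
    by rewrite fE1 // f1U.
  by rewrite fE2 // f2V ?orbT // kd.
- move=> iK; have [iI | iI] := boolP (i \in I).
    by rewrite fE1 // f1d.
  by rewrite fE2 // f2d // kd.
move=> j iK jK fij.
have ijI : (i \in I) = (j \in I).
  rewrite -!fUE //; apply/idP/idP=> [fiU | fjU].
    exact: (subsetP (porbit_sub siU fiU)).
  by rewrite porbit_sym in fij; apply: (subsetP (porbit_sub siU fjU)).
have [iI | iI] := boolP (i \in I); have jI := iI; rewrite ijI in jI.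
  by apply: f1j => //; rewrite -!fE1.
by apply: f2j; rewrite ?kd // -!fE2.
Qed.

Lemma card_placements0 U : #|placements U set0| = 1.
Proof.
rewrite -[RHS](cards1 [ffun _ : L => y0]); apply: eq_card => f; rewrite in_set1.
apply/placementP/eqP=> [[off _ _ _] | ->].
  by apply/ffunP=> i; rewrite ffunE off // !inE.
by split=> i; rewrite ?inE // ffunE.
Qed.

(** A single root can be any half-edge of the vertex, provided that its degree
    is the prescribed one. *)
Lemma card_placements_porbit1 b r :
  #|placements (porbit si b) [set r]| = (#|porbit si b| == d r) * d r.
Proof.
have eqb h : h \in porbit si b -> porbit si h = porbit si b.
  by rewrite -eq_porbit_mem => /eqP.
have [e | ne] := eqVneq #|porbit si b| (d r); last first.
  rewrite mul0n; apply: eq_card0 => f; apply/negbTE/negP=> /placementP[_ fb fd _].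
  case/eqP: ne; rewrite -fd ?set11 //; congr #|pred_of_set _|.
  by rewrite eqb // fb ?set11.
rewrite mul1n -e; pose g h : {ffun L -> H} := [ffun i => if i == r then h else y0].
have gI : injective g by move=> h h' /ffunP/(_ r); rewrite !ffunE eqxx.
rewrite -(card_imset _ gI); apply: eq_card => f; apply/placementP/imsetP.
  case=> off fb _ _; exists (f r); first by rewrite fb ?set11.
  apply/ffunP=> i; rewrite ffunE; have [-> //|ni] := eqVneq i r.
  by rewrite off // !inE.
case=> h hb ->; split=> i; rewrite !inE ?ffunE.
- by move/negbTE->.
- by move=> ->.
- by move/eqP->; rewrite eqxx eqb.
by move=> j; rewrite !inE => /eqP-> /eqP->.
Qed.

Lemma card_placements_porbit_gt1 b E : 1 < #|E| -> #|placements (porbit si b) E| = 0.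
Proof.
move=> /card_gt1P[i [j [iE jE ij]]]; apply: eq_card0 => f.
apply/negbTE/negP=> /placementP[_ fb _ fj]; case/eqP: ij; apply: fj => //.
have := fb i iE; rewrite -eq_porbit_mem => /eqP->; exact: fb.
Qed.

(** Outside the vertex of a, the half-edges form three unions of vertices: the
    vertex of b, the rest of A and the rest of the complement of A.  The two sums
    correspond to no root at the vertex of b, and to one root r there; two roots
    cannot share a vertex. *)
Lemma root_choices_split A a b K : si \in 'N(A | 'P)%g -> a \in A -> b \notin A ->
  root_choices si setT a (degs K) =
  \sum_(I : {set L}) \sum_(J : {set L} | (I :|: J == K) && (I :&: J == set0))
      root_choices si A a (degs I) * root_choices si (~: A) b (degs J)
  + \sum_(r in K) \sum_(I : {set L})
      \sum_(J : {set L} | (I :|: J == K :\ r) && (I :&: J == set0))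
      (#|porbit si b| == d r) * (d r *
        root_choices si A a (degs I) * root_choices si (~: A) b (degs J)).
Proof.
move=> siA aA bA; pose UA := A :\: porbit si a; pose UB := ~: A :\: porbit si b.
have siB : si \in 'N(~: A | 'P)%g by rewrite astabsC.
have pA : porbit si a \subset A by apply: porbit_sub.
have pB : porbit si b \subset ~: A by apply: porbit_sub; rewrite ?in_setC.
have siUA : si \in 'N(UA | 'P)%g.
  by apply: (subsetP (astabsD _ _ _)); rewrite inE siA porbit_astabs.
have UE : setT :\: porbit si a = porbit si b :|: (UA :|: UB).
  apply/setP=> h; have /implyP := subsetP pA h; have /implyP := subsetP pB h.
  rewrite !inE; case: (h \in A); case: (h \in porbit si a) => //;
    by case: (h \in porbit si b).
have dU : [disjoint porbit si b & UA :|: UB].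
  rewrite -setI_eq0; apply/eqP/setP=> h; have /implyP := subsetP pB h.
  by rewrite !inE; case: (h \in A); case: (h \in porbit si b); rewrite ?andbF.
have dAB : [disjoint UA & UB].
  rewrite -setI_eq0; apply/eqP/setP=> h; rewrite !inE.
  by case: (h \in A); rewrite ?andbF.
pose F K' := \sum_(I : {set L} | I \subset K')
  root_choices si A a (degs I) * root_choices si (~: A) b (degs (K' :\: I)).
have FE K' : #|placements (UA :|: UB) K'| = F K'.
  rewrite card_placementsU //; apply: eq_bigr => I _.
  by rewrite !root_choices_placements.
rewrite root_choices_placements UE card_placementsU ?porbit_astabs //.
rewrite sum_set_splits (bigD1 set0) ?sub0set //= card_placements0 mul1n setD0 FE.
congr (_ + _).
rewrite (bigID (mem (set1 @: K))) /= [X in _ + X]big1 ?addn0; last first.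
  move=> E /andP[/andP[EK E0] nE]; rewrite card_placements_porbit_gt1 //.
  rewrite ltn_neqAle card_gt0 E0 andbT eq_sym; apply: contraNN nE => /cards1P[r e].
  by rewrite e imset_f // -sub1set -e.
rewrite (eq_bigl (mem (set1 @: K))); last first.
  move=> E /=; apply/andP/idP=> [[_ //] | /[dup] EK /imsetP[r rK ->]].
  by rewrite sub1set rK imset_f // -card_gt0 cards1.
rewrite big_imset /=; last by move=> r r' _ _; apply: set1_inj.
apply: eq_bigr => r rK; rewrite card_placements_porbit1 FE.
rewrite sum_set_splits big_distrr /=; by apply: eq_bigr => I _; rewrite !mulnA.
Qed.

End Placements.
End Roots.

(** * Transport along an injection *)
Section Transport.
Variables (H1 H : finType) (f : H1 -> H).
Hypothesis fI : injective f.
Implicit Types (al si u : {perm H1}) (x y z : H1) (s : {perm H1} * {perm H1}).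

Definition ext_fun u (h : H) : H :=
  if [pick x | f x == h] is Some x then f (u x) else h.

Lemma ext_funE u x : ext_fun u (f x) = f (u x).
Proof.
rewrite /ext_fun; case: pickP => [y /eqP/fI-> // | /(_ x)].
by rewrite eqxx.
Qed.

Lemma ext_fun_inj u : injective (ext_fun u).
Proof.
have K : cancel (ext_fun u) (ext_fun u^-1).
  move=> h; rewrite {2}/ext_fun; case: pickP => [x /eqP<- | no].
    by rewrite ext_funE permK.
  by rewrite /ext_fun; case: pickP => // x; rewrite no.
exact: can_inj K.
Qed.

Definition ext u : {perm H} := perm (@ext_fun_inj u).

Lemma extE u x : ext u (f x) = f (u x).
Proof. by rewrite permE ext_funE. Qed.

Let C : {set H} := f @: setT.

Lemma ext_out u h : h \notin C -> ext u h = h.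
Proof.
move=> hC; rewrite permE /ext_fun; case: pickP => // x /eqP e.
by rewrite -e imset_f ?inE in hC.
Qed.

Lemma ext_on u : perm_on C (ext u).
Proof. by apply/subsetP=> h; rewrite inE; apply: contraNT => /ext_out->. Qed.

Lemma ext_inj : injective ext.
Proof. by move=> u v e; apply/permP=> x; apply: fI; rewrite -!extE e. Qed.

(** By counting: [ext] is injective, and the permutations with support in C are
    as many as those of H1. *)
Lemma ext_onto (t : {perm H}) : perm_on C t -> exists u, t = ext u.
Proof.
suff /eqP/setP/(_ t) : ext @: setT == [set t | perm_on C t].
  by rewrite inE => <- /imsetP[u _ ->]; exists u.
rewrite eqEcard (card_imset _ ext_inj) cardsE (card_perm C) (card_imset _ fI).
rewrite -card_perm; apply/andP; split.
  by apply/subsetP=> _ /imsetP[u _ ->]; rewrite inE ext_on.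
by apply: subset_leq_card; apply/subsetP=> u _; rewrite inE.
Qed.

Lemma porbit_ext u x : porbit (ext u) (f x) = f @: porbit u x.
Proof.
apply/eqP; rewrite eqEsubset; apply/andP; split.
  apply: porbit_sub; last by rewrite imset_f ?porbit_id.
  apply/astabs_permP=> _ /imsetP[y yo ->]; rewrite extE imset_f //.
  by rewrite astabs_permE ?porbit_astabs.
rewrite sub_imset_pre; apply: porbit_sub; last by rewrite inE porbit_id.
apply/astabs_permP=> y; rewrite !inE -extE => yo.
by rewrite astabs_permE ?porbit_astabs.
Qed.

Lemma card_porbit_ext u x : #|porbit (ext u) (f x)| = #|porbit u x|.
Proof. by rewrite porbit_ext card_imset. Qed.

Lemma ncycles_ext u : ncycles (ext u) C = ncycles u setT.
Proof.
rewrite /ncycles /C -imset_comp.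
rewrite (eq_imset (g := (fun X : {set H1} => f @: X) \o porbit u)); last first.
  by move=> x /=; rewrite porbit_ext.
by rewrite imset_comp card_imset //; apply: imset_inj.
Qed.

Lemma component_ext al si x :
  component (ext al) (ext si) (f x) = f @: component al si x.
Proof.
have N := component_astabs al si x.
have N' := component_astabs (ext al) (ext si) (f x).
apply/eqP; rewrite eqEsubset; apply/andP; split.
  apply: component_sub; rewrite ?imset_f ?component_id //;
    apply/astabs_permP=> _ /imsetP[y yo ->]; rewrite extE imset_f //.
    by rewrite astabs_permE ?N.
  by rewrite astabs_permE ?N.
rewrite sub_imset_pre; apply: component_sub; last by rewrite inE component_id.
  by apply/astabs_permP=> y; rewrite !inE -extE => yo; rewrite astabs_permE ?N'.
by apply/astabs_permP=> y; rewrite !inE -extE => yo; rewrite astabs_permE ?N'.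
Qed.

Definition ext2 s : {perm H} * {perm H} := (ext s.1, ext s.2).

Lemma ext2_tree x s :
  is_tree C set0 (f x) (ext2 s) = is_tree setT set0 x s.
Proof.
case: s => al si; rewrite /is_tree /= !ext_on component_ext ncycles_ext.
rewrite (inj_eq (imset_inj fI)) !cards0 card_imset //.
have onT (u : {perm H1}) : perm_on setT u by apply/subsetP.
rewrite !onT /=; congr [&& _, _ & _].
  apply/forallP/forallP=> I h; last first.
    have [/imsetP[y _ ->] | nh] := boolP (h \in C); last by rewrite !ext_out.
    by rewrite !extE (eqP (I y)).
  by rewrite -(inj_eq fI) -!extE.
apply/eqP/eqP=> /setP no; apply/setP=> h.
  by have := no (f h); rewrite !inE extE (inj_eq fI) imset_f ?inE.
rewrite !inE; have [/imsetP[y _ ->] | //] := boolP (h \in C).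
by have := no y; rewrite !inE extE (inj_eq fI).
Qed.

Lemma root_choices_ext u x ds :
  root_choices (ext u) C (f x) ds = root_choices u setT x ds.
Proof.
pose F (s : (size ds).-tuple H1) := map_tuple f s.
have FI : injective F.
  by move=> s s' /(congr1 val) /= /(inj_map fI)/val_inj.
have goodE (s : seq H1) : good_roots (ext u) C (f x) ds (map f s)
    = good_roots u setT x ds s.
  rewrite /good_roots -!map_cons -!map_comp.
  have -> : all (mem C) (map f s) by apply/allP=> _ /mapP[y _ ->]; apply: imset_f.
  have -> : all (mem [set: H1]) s by apply/allP=> y; rewrite /= inE.
  rewrite (eq_map (g := (fun X : {set H1} => f @: X) \o porbit u)); last first.
    by move=> y /=; rewrite porbit_ext.
  rewrite map_comp (map_inj_uniq (imset_inj fI)).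
  congr [&& _, _ & _ == ds]; apply: eq_map => y /=; exact: card_porbit_ext.
rewrite /root_choices -(card_imset _ FI); apply: eq_card => s.
rewrite inE; apply/idP/imsetP=> [gs | [s' gs' ->]]; last first.
  by rewrite inE in gs'; rewrite /= goodE.
pose g h := odflt x [pick z | f z == h].
have fg : {in C, cancel g f}.
  move=> _ /imsetP[y _ ->]; rewrite /g; case: pickP => [z /eqP// | /(_ y)].
  by rewrite eqxx.
have sE : map f (map g s) = s.
  rewrite -map_comp map_id_in // => h hs; apply: fg.
  by have /and3P[/allP/(_ h hs)] := gs.
exists (map_tuple g s); last by apply: val_inj.
by rewrite inE -goodE /= sE.
Qed.

Lemma sum_trees_ext (G : H -> {perm H} * {perm H} -> nat) :
  \sum_(y in C) \sum_(s | is_tree C set0 y s) G y s =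
  \sum_x \sum_(s | is_tree setT set0 x s) G (f x) (ext2 s).
Proof.
rewrite big_imset /=; last by move=> ? ? _ _; apply: fI.
apply: eq_big => [x | x _]; first by rewrite inE.
rewrite (eq_bigl (mem (ext2 @: [set s | is_tree setT set0 x s]))) /=; last first.
  move=> s; apply/idP/imsetP => [sT | [s1]]; last first.
    by rewrite inE => s1T ->; rewrite ext2_tree.
  have /is_treeP[/ext_onto[u1 e1] /ext_onto[u2 e2] _] := sT.
  have e : s = ext2 (u1, u2) by rewrite /ext2 /= -e1 -e2; case: (s).
  by exists (u1, u2); rewrite // inE -ext2_tree -e.
rewrite big_imset /=; first by apply: eq_bigl => s; rewrite inE.
by move=> [u1 u2] [v1 v2] _ _ [/ext_inj-> /ext_inj->].
Qed.

End Transport.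

(** * Isomorphism classes and labelled trees *)
Section Relabel.
Variable H : finType.

Lemma is_plane_treeE e (al si : {perm H}) x :
  is_plane_tree e al si = (#|H| == e.*2) && is_tree setT set0 x (al, si).
Proof.
rewrite /is_plane_tree /is_tree /=; have [cH | //] := eqVneq #|H| e.*2.
have onT (u : {perm H}) : perm_on setT u by apply/subsetP.
rewrite !onT /=.
have -> : #|porbits si| = ncycles si setT.
  by apply: eq_card => X; apply/imsetP/imsetP=> -[y _ ->]; exists y.
rewrite cards0 cardsT cH.
have -> : (ncycles si [set: H] == e.+1) = ((ncycles si setT).*2 + 0 == e.*2 + 2).
  by rewrite addn0 addn2 -doubleS (inj_eq double_inj).
have -> : [transitive <<[set al; si]>>%g, on [set: H] | 'P]
    = (component al si x == setT).
  apply/idP/eqP=> [tr | e0].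
    by have := atransP tr x; rewrite inE; apply.
  by rewrite -e0; apply: atrans_orbit.
rewrite [RHS]andbA; congr (_ && _).
apply/forallP/andP=> [I | [/forallP I /eqP/setP no] h].
  split; first by apply/forallP=> h; case/andP: (I h).
  by apply/eqP/setP=> h; rewrite !inE; case/andP: (I h) => /negbTE->.
by rewrite I andbT; have := no h; rewrite !inE /= => ->.
Qed.

Variable n : nat.
Implicit Types (t : rooted_map H n.+1) (phi : {perm H}).

Definition relabel t phi : rooted_map H n.+1 :=
  (ext2 (@perm_inj _ phi) t.1, map_tuple phi t.2).

Lemma ext_conj phi (u : {perm H}) : ext (@perm_inj _ phi) u = (phi^-1 * u * phi)%g.
Proof.
by apply/permP=> h; rewrite -{1}[h](permKV phi) extE !permM.
Qed.

Lemma rooted_isoE t t' : rooted_iso t t' = (t' \in relabel t @: setT).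
Proof.
case: t t' => [[al si] r] [[al' si'] r'].
apply/existsP/imsetP=> [[phi /and3P[/eqP ea /eqP es /forallP er]] | [phi _]].
  rewrite /rm_alpha /rm_sigma /= in ea es.
  exists phi; rewrite // /relabel /ext2 /= !ext_conj ea es.
  rewrite !mulgA !mulVg !mul1g -!mulgA !mulVg !mulg1.
  by congr (_, _); apply: eq_from_tnth => k; rewrite tnth_map (eqP (er k)).
case=> -> -> ->; exists phi; rewrite /rm_alpha /rm_sigma /= !ext_conj.
rewrite !mulgA !mulgV !mul1g -!mulgA !mulgV !mulg1.
by rewrite !eqxx; apply/forallP=> k; rewrite /rm_roots /= tnth_map.
Qed.

Lemma relabel_rooted_tree e t phi :
  is_rooted_tree e (relabel t phi) = is_rooted_tree e t.
Proof.
rewrite /is_rooted_tree; congr (_ && _).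
  have CT : [set phi x | x in [set: H]] = setT.
    apply/eqP; rewrite -subTset; apply/subsetP=> h _.
    by rewrite -(permKV phi h) imset_f.
  pose x := thead t.2; rewrite (is_plane_treeE _ _ _ (phi x)) (is_plane_treeE _ _ _ x).
  have := ext2_tree (@perm_inj _ phi) x (rm_alpha t, rm_sigma t).
  by rewrite CT => <-.
rewrite -map_comp (eq_map (g := (fun X : {set H} => phi @: X) \o porbit (rm_sigma t))).
  by rewrite [in LHS]map_comp map_inj_uniq //; apply: imset_inj perm_inj.
by move=> h /=; rewrite porbit_ext.
Qed.

Lemma relabel_degrees t phi : root_degrees (relabel t phi) = root_degrees t.
Proof.
rewrite /root_degrees -map_comp; apply: eq_map => h /=.
by rewrite card_porbit_ext.
Qed.

(** Rooted trees have no automorphism: the half-edges on which phi and psi agree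
    form a stable set, which contains the roots and hence is everything. *)
Lemma relabel_inj e t : is_rooted_tree e t -> injective (relabel t).
Proof.
case: t => [[al si] r] /andP[tT _] phi psi [].
have [x rx] : exists x, x \in r by exists (thead r); rewrite (tuple_eta r) mem_head.
move: tT; rewrite (is_plane_treeE _ _ _ x) => /andP[_ /is_treeP[_ _ [_ _ /= cT _]]].
move=> ea es er.
have agree (u : {perm H}) h : ext (@perm_inj _ phi) u = ext (@perm_inj _ psi) u ->
    phi h = psi h -> phi (u h) = psi (u h).
  by move=> eu eh; rewrite -(extE (@perm_inj _ phi)) -(extE (@perm_inj _ psi)) eu eh.
have sub : component al si x \subset [set h | phi h == psi h].
  apply: component_sub; last by rewrite inE; have /eq_in_map/(_ x rx)-> := er.
    by apply/astabs_permP=> h; rewrite !inE => /eqP eh; rewrite (agree _ _ ea eh).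
  by apply/astabs_permP=> h; rewrite !inE => /eqP eh; rewrite (agree _ _ es eh).
apply/permP=> h; have := subsetP sub h.
by rewrite cT !inE => /(_ isT)/eqP.
Qed.

End Relabel.

(** Each isomorphism class is the orbit of a tree under relabelling, of size
    (2e)! by [relabel_inj]. *)
Lemma card_labelled n e ds : 0 < e ->
  #|[set t : rooted_map 'I_(e.*2) n.+1 |
              is_rooted_tree e t && prefix ds (root_degrees t)]|
  = (e.*2)`! * T n.+1 e ds.
Proof.
rewrite /T; case: e => // e _; set S := [set t | _].
rewrite mulnC; apply: card_uniform_partition; last first.
  apply: equivalence_partitionP => t t' t'' _ _ _.
  exact: rooted_iso_equiv.
move=> _ /imsetP[t tS ->].
have -> : [set y in S | rooted_iso t y] = relabel t @: setT.
  apply/setP=> t'; rewrite inE rooted_isoE andb_idl // => /imsetP[phi _ ->].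
  by move: tS; rewrite !inE relabel_rooted_tree relabel_degrees.
rewrite card_imset; first by rewrite cardsT; apply: card_Sn.
by apply: (@relabel_inj _ _ e.+1); move: tS; rewrite inE => /andP[].
Qed.

Section Tuples.
Variable H : finType.

Lemma sum_tuple_cons n (F : n.+1.-tuple H -> nat) :
  \sum_t F t = \sum_x \sum_(s : n.-tuple H) F (cons_tuple x s).
Proof.
rewrite pair_bigA /=.
pose g (p : H * n.-tuple H) : n.+1.-tuple H := cons_tuple p.1 p.2.
rewrite (reindex g) //; exists (fun t => (thead t, behead_tuple t)).
  by case=> x s _; congr (_, _); apply: val_inj.
by move=> t _; rewrite [RHS]tuple_eta; apply: val_inj.
Qed.

(** Needed where the root of unconstrained degree comes last. *)
Lemma sum_tuple_rcons n (F : n.+1.-tuple H -> nat) :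
  \sum_t F t = \sum_x \sum_(s : n.-tuple H) F (rcons_tuple s x).
Proof.
rewrite (reindex (fun t : n.+1.-tuple H => rot_tuple 1 t)); last first.
  by exists (fun t : n.+1.-tuple H => rotr_tuple 1 t) => t _; apply: val_inj;
    rewrite /= ?rotK ?rotrK.
rewrite sum_tuple_cons; apply: eq_bigr => x _; apply: eq_bigr => s _.
by congr F; apply: val_inj; rewrite /= rot1_cons.
Qed.

End Tuples.

Section Labelled.
Variable e : nat.
Hypothesis e0 : 0 < e.
Notation H := 'I_(e.*2).

Lemma card_labelled_sum n (Q : {perm H} -> pred (seq H)) (P : seq int) :
    (forall al si (r : n.+1.-tuple H), uniq [seq porbit si h | h <- r] &&
      prefix P (root_degrees (al, si, r)) = Q si r) ->
  (e.*2)`! * T n.+1 e P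
  = \sum_(s : {perm H} * {perm H}) \sum_(r : n.+1.-tuple H)
      (is_plane_tree e s.1 s.2 && Q s.2 r).
Proof.
move=> QE; rewrite -card_labelled // -sum1_card pair_bigA /= big_mkcond /=.
apply: eq_bigr => -[[al si] r] _; rewrite inE /is_rooted_tree -andbA QE /=.
by case: (_ && _).
Qed.

Lemma sum_plane_trees (F : H -> {perm H} -> nat) :
  \sum_(s : {perm H} * {perm H}) \sum_x is_plane_tree e s.1 s.2 * F x s.2
  = \sum_x \sum_(s | is_tree setT set0 x s) F x s.2.
Proof.
rewrite exchange_big; apply: eq_bigr => x _ /=; rewrite [RHS]big_mkcond.
apply: eq_bigr => -[al si] _; rewrite (is_plane_treeE _ _ _ x) card_ord eqxx /=.
by case: is_tree; rewrite ?mul1n.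
Qed.

Lemma root_degreesE n al si (r : n.-tuple H) :
  root_degrees (al, si, r) = map Posz [seq #|porbit si h| | h <- r].
Proof. by rewrite -map_comp. Qed.

Lemma card_trees_prescribed dm ds :
  (e.*2)`! * T (size ds).+1 e (Posz dm :: map Posz ds)
  = \sum_(x : H) \sum_(s | is_tree setT set0 x s)
      (#|porbit s.2 x| == dm) * root_choices s.2 setT x ds.
Proof.
rewrite (card_labelled_sum (Q := fun si r => uniq [seq porbit si h | h <- r]
    && ([seq #|porbit si h| | h <- r] == dm :: ds))); last first.
  move=> al si r; congr (_ && _); rewrite root_degreesE -map_cons.
  rewrite prefixE size_map take_oversize ?size_map ?size_tuple //.
  by rewrite (inj_eq (inj_map _)) // => ? ? [].
rewrite -(sum_plane_trees (fun x si =>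
    (#|porbit si x| == dm) * root_choices si setT x ds)).
apply: eq_bigr => -[al si] _ /=.
rewrite sum_tuple_cons; apply: eq_bigr => x _.
rewrite /root_choices -sum1_card mulnA big_distrr /= [RHS]big_mkcond /=.
apply: eq_bigr => s _; rewrite inE /good_roots /= muln1 -mulnb -mulnb.
have -> : all (mem [set: H]) s by apply/allP=> h; rewrite /= inE.
rewrite eqseq_cons /=.
by case: is_plane_tree; case: (_ && _); case: (_ == dm); case: (_ == ds).
Qed.

Lemma card_trees_free_root ds :
  (e.*2)`! * T (size ds).+1 e (map Posz ds)
  = \sum_(x : H) \sum_(s | is_tree setT set0 x s) root_choices s.2 setT x ds.
Proof.
rewrite (card_labelled_sum (Q := fun si r => uniq [seq porbit si h | h <- r]
    && (take (size ds) [seq #|porbit si h| | h <- r] == ds))); last first.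
  move=> al si r; congr (_ && _); rewrite root_degreesE prefixE size_map.
  rewrite -(map_take _ Posz).
  by rewrite (inj_eq (inj_map _)) // => ? ? [].
rewrite -(sum_plane_trees (fun x si => root_choices si setT x ds)).
apply: eq_bigr => -[al si] _ /=.
rewrite sum_tuple_rcons; apply: eq_bigr => x _.
rewrite /root_choices -sum1_card big_distrr /= [RHS]big_mkcond /=.
apply: eq_bigr => s _; rewrite inE /good_roots /= muln1.
have -> : all (mem [set: H]) s by apply/allP=> h; rewrite /= inE.
rewrite !map_rcons -!cats1 take_size_cat ?size_map ?size_tuple // cats1 rcons_uniq.
by rewrite /=; case: is_plane_tree; case: ifP => //= ->.
Qed.

End Labelled.

(** * Planted trees *)
Section Planted.
Variable H : finType.
Implicit Types (A C : {set H}) (a b x y h : H) (ds : seq nat).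

(** The leg contributes one to the degree of its vertex.  The weight w covers
    both a prescribed and a free degree. *)
Lemma sum_planted_rooted A a e (w : nat -> nat) ds :
    a \in A -> #|A| = e.*2.+1 -> 0 < e ->
  \sum_(p | is_tree A [set a] a p)
     w #|porbit p.2 a| * root_choices p.2 A a ds
  = \sum_(x : 'I_(e.*2)) \sum_(s | is_tree setT set0 x s)
     w #|porbit s.2 x|.+1 * root_choices s.2 setT x ds.
Proof.
move=> aA cA e0; set C := A :\ a.
have cC : #|C| = e.*2 by have := cardsD1 a A; rewrite aA cA => -[].
have aC : a \notin C by rewrite !inE eqxx.
have C0 : C != set0 by rewrite -card_gt0 cC double_gt0.
have AE : A = a |: C by rewrite setD1K.
pose f (i : 'I_(e.*2)) := nth a (enum C) i.
have ltC (i : 'I_(e.*2)) : i < size (enum C) by rewrite -cardE cC.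
have fI : injective f.
  by move=> i j /eqP; rewrite nth_uniq ?ltC ?enum_uniq // => /eqP/val_inj.
have fC : f @: setT = C.
  apply/eqP; rewrite eqEcard card_imset // cardsT card_ord cC leqnn andbT.
  by apply/subsetP=> _ /imsetP[i _ ->]; rewrite -mem_enum mem_nth.
rewrite {1}AE sum_trees_plant //.
pose G x (s : {perm H} * {perm H}) := w #|porbit s.2 x|.+1 * root_choices s.2 C x ds.
transitivity (\sum_(x in C) \sum_(s | is_tree C set0 x s) G x s).
  apply: eq_bigr => x xC; apply: eq_bigr => s /is_treeP[_ sC _] /=.
  have sa : s.2 a = a by rewrite (out_perm sC).
  have xa : x != a by apply: contraNneq aC => <-.
  rewrite AE root_choices_insert // porbit_insert // cardsU1.
  by rewrite porbit_sym porbit_fix // inE xa.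
rewrite -fC sum_trees_ext //; apply: eq_bigr => x _; apply: eq_bigr => s _.
by rewrite /G /= card_porbit_ext // -fC root_choices_ext.
Qed.

(** The bare leg is the only planted tree without edges. *)
Lemma sum_planted_trivial A a (w : nat -> nat) ds : a \in A -> #|A| = 1 ->
  \sum_(p | is_tree A [set a] a p)
     w #|porbit p.2 a| * root_choices p.2 A a ds = w 1 * (ds == [::]).
Proof.
move=> aA cA.
have {aA} AE : A = [set a].
  by apply/esym/eqP; rewrite eqEcard sub1set aA cA cards1.
rewrite AE (big_pred1 (1, 1)%g) /=; last first.
  case=> al si; apply/is_treeP/eqP => [[/= alA siA _] | [-> ->]].
    by rewrite (perm_on_id alA) ?(perm_on_id siA) ?cards1.
  have N1 : (1 : {perm H})%g \in 'N([set a] | 'P)%g by apply: group1.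
  rewrite !perm_on1 /=; split=> //; split=> //.
  - by move=> h; rewrite !perm1.
  - by apply/setP=> h; rewrite !inE perm1 eqxx andbT.
  - apply/eqP; rewrite eqEsubset component_sub ?set11 //=.
    by rewrite sub1set component_id.
  - by rewrite /ncycles imset_set1 !cards1.
rewrite porbit_fix ?perm1 // cards1; congr (_ * _).
case: ds => [|dm ds] /=.
  rewrite /root_choices; apply/eqP/cards1P; exists [tuple].
  by apply/setP=> s; rewrite !inE (tuple0 s) /good_roots eqxx.
apply: eq_card0 => s; rewrite inE /good_roots; apply/negbTE/negP=> /and3P[].
rewrite (tuple_eta s) /= inE => /andP[/eqP-> _].
by rewrite inE eqxx.
Qed.

Lemma sum_planted_prescribed A a e dm ds : a \in A -> #|A| = e.*2.+1 ->
  \sum_(p | is_tree A [set a] a p)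
     (#|porbit p.2 a| == dm) * root_choices p.2 A a ds
  = (e.*2)`! * T (size ds).+1 e ((Posz dm - 1)%R :: map Posz ds).
Proof.
move=> aA cA; case: e cA => [|e] cA.
  rewrite (sum_planted_trivial (fun k => k == dm)) //= mul1n.
  case: ds => [|? ds]; last by rewrite muln0.
  by case: dm => [|[|dm]].
rewrite (@sum_planted_rooted A a e.+1 (fun k => k == dm)) //.
(* For dm = 0 both sides vanish: a vertex contains its leg, and no vertex has
   degree -1. *)
case: dm => [|dm].
  rewrite big1 => [|x _]; last by rewrite big1.
  rewrite /T; apply/esym/eqP; rewrite muln_eq0 cards_eq0; apply/orP; right.
  set S := [set _ | _].
  suff -> : S = set0 by rewrite /equivalence_partition /preim_partition imset0.
  apply/setP=> t; rewrite !inE; apply/negP=> /andP[_].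
  by rewrite /root_degrees; case/tupleP: (rm_roots t).
have -> : (Posz dm.+1 - 1)%R = Posz dm by lia.
by rewrite card_trees_prescribed.
Qed.

Lemma sum_planted_free_root A a e ds : a \in A -> #|A| = e.*2.+1 ->
  \sum_(p | is_tree A [set a] a p) root_choices p.2 A a ds
  = (e.*2)`! * T (size ds).+1 e (map Posz ds).
Proof.
move=> aA cA; under eq_bigr do rewrite -[root_choices _ _ _ _]mul1n.
case: e cA => [|e] cA.
  rewrite (sum_planted_trivial (fun=> 1)) //= mul1n.
  by case: ds.
rewrite (@sum_planted_rooted A a e.+1 (fun=> 1)) // card_trees_free_root //.
by apply: eq_bigr => x _; apply: eq_bigr => s _; rewrite mul1n.
Qed.

Lemma planted_odd A a p : is_tree A [set a] a p -> odd #|A|.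
Proof. by case/is_treeP=> _ _ [_ _ _]; rewrite cards1; lia. Qed.

End Planted.

Lemma exchange_big_inner (S1 S2 R : finType)
    (P1 : pred S1) (P2 : pred S2) (P3 : pred R) (F : S1 -> S2 -> R -> nat) :
  \sum_(p | P1 p) \sum_(q | P2 q) \sum_(r | P3 r) F p q r
  = \sum_(r | P3 r) \sum_(p | P1 p) \sum_(q | P2 q) F p q r.
Proof.
by rewrite [RHS]exchange_big /=; apply: eq_bigr => p _; apply: exchange_big.
Qed.

(** * The recursion *)
Section Recursion.
Variables (L : finType) (v : L) (d : L -> nat).
Let K := [set~ v].

Definition Tsub e (dm : int) (I : {set L}) :=
  T (#|I| + 1) e (dm :: [seq Posz (d i) | i <- enum I]).
Definition Tsub_free e (I : {set L}) :=
  T (#|I| + 1) e [seq Posz (d i) | i <- enum I].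

(** The summand of the recursion for given e1 and e2, over any type of labels. *)
Definition cut_sum e1 e2 : nat :=
  \sum_(I : {set L})
      \sum_(J : {set L} | (I :|: J == K) && (I :&: J == set0))
        Tsub e1 (Posz (d v) - 1)%R I * Tsub_free e2 J
    + \sum_(r : L | r != v) \sum_(I : {set L})
      \sum_(J : {set L} | (I :|: J == K :\ r) && (I :&: J == set0))
        d r * Tsub e1 (Posz (d v) - 1)%R I * Tsub e2 (Posz (d r) - 1)%R J.

(** For a fixed cut, the sum over the two planted trees factors, because the
    degrees of a and b and the choices of roots on either side depend on that
    side only.  The weight d r * [deg b = d r] becomes the factor d r and the
    prescribed degree of the leg b. *)
Lemma sum_glued (H : finType) (A : {set H}) a b e1 e2 :
    a \in A -> b \notin A -> #|A| = e1.*2.+1 -> #|~: A| = e2.*2.+1 ->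
  \sum_(p | is_tree A [set a] a p) \sum_(q | is_tree (~: A) [set b] b q)
     (#|porbit (glue a b p q).2 a| == d v)
      * root_choices (glue a b p q).2 setT a (degs d K)
  = (e1.*2)`! * (e2.*2)`! * cut_sum e1 e2.
Proof.
move=> aA bA cA cB; have bB : b \in ~: A by rewrite inE.
pose X (p : {perm H} * {perm H}) I :=
  (#|porbit p.2 a| == d v) * root_choices p.2 A a (degs d I).
pose Y (q : {perm H} * {perm H}) J := root_choices q.2 (~: A) b (degs d J).
pose Z (q : {perm H} * {perm H}) r J :=
  (#|porbit q.2 b| == d r) * root_choices q.2 (~: A) b (degs d J).
have XE I : \sum_(p | is_tree A [set a] a p) X p I
    = (e1.*2)`! * Tsub e1 (Posz (d v) - 1)%R I.
  rewrite (@sum_planted_prescribed _ A a e1) // /Tsub size_map -cardE.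
  by rewrite -map_comp addn1.
have YE J : \sum_(q | is_tree (~: A) [set b] b q) Y q J = (e2.*2)`! * Tsub_free e2 J.
  rewrite (@sum_planted_free_root _ (~: A) b e2) // /Tsub_free size_map -cardE.
  by rewrite -map_comp addn1.
have ZE r J : \sum_(q | is_tree (~: A) [set b] b q) Z q r J
    = (e2.*2)`! * Tsub e2 (Posz (d r) - 1)%R J.
  rewrite (@sum_planted_prescribed _ (~: A) b e2) // /Tsub size_map -cardE.
  by rewrite -map_comp addn1.
transitivity (\sum_(p | is_tree A [set a] a p) \sum_(q | is_tree (~: A) [set b] b q)
   (\sum_(I : {set L} | I \subset K) X p I * Y q (K :\: I)
    + \sum_(r in K) \sum_(I : {set L} | I \subset K :\ r)
        X p I * (d r * Z q r (K :\ r :\: I)))).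
  apply: eq_bigr => p pT; apply: eq_bigr => q qT.
  have [_ [sN sA sB _ _]] := glueP aA bA pT qT.
  have sNB : (glue a b p q).2 \in 'N(~: A | 'P)%g by rewrite astabsC.
  rewrite (root_choices_split d a K sN aA bA) mulnDr sum_set_splits big_distrr /=.
  congr (_ + _).
    apply: eq_bigr => I _; rewrite /X /Y (eq_in_porbit sN sA aA).
    by rewrite (eq_in_root_choices _ sN sA aA) (eq_in_root_choices _ sNB sB bB) mulnA.
  rewrite big_distrr /=; apply: eq_bigr => r _.
  rewrite sum_set_splits big_distrr /=; apply: eq_bigr => I _.
  rewrite /X /Z (eq_in_porbit sN sA aA) (eq_in_porbit sNB sB bB).
  rewrite (eq_in_root_choices _ sN sA aA) (eq_in_root_choices _ sNB sB bB).
  rewrite -!mulnA; congr (_ * _); rewrite mulnCA [RHS]mulnCA; congr (_ * _).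
  exact: mulnCA.
under eq_bigr do rewrite big_split /=; rewrite big_split /=.
rewrite exchange_big_inner [X in _ + X]exchange_big_inner /cut_sum mulnDr.
congr (_ + _).
  rewrite sum_set_splits big_distrr /=; apply: eq_bigr => I _.
  by rewrite -big_distrlr /= XE YE mulnACA.
rewrite big_distrr /=; apply: eq_big => [r | r _]; first by rewrite !inE.
rewrite sum_set_splits big_distrr exchange_big_inner /=; apply: eq_bigr => I _.
rewrite -big_distrlr /= XE -big_distrr /= ZE.
rewrite -!mulnA; congr (_ * _); rewrite mulnCA [X in _ * X]mulnCA.
exact: mulnCA.
Qed.

Lemma T_cut e : 0 < e ->
  T #|L| e (Posz (d v) :: [seq Posz (d i) | i <- enum K])
  = \sum_(e1 < e) cut_sum e1 (e - e1.+1).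
Proof.
move=> e0; apply/eqP; rewrite -(eqn_pmul2l (fact_gt0 e.*2)); apply/eqP.
have cL : #|L| = (size (degs d K)).+1.
  by rewrite size_map -cardE cardsC1 prednK //; apply/card_gt0P; exists v.
rewrite cL map_comp (card_trees_prescribed e0).
pose H : finType := 'I_(e.*2).
(* The contribution of a cut with given A; the inner sum has at most one term,
   and none when #|A| is even, as a planted tree has odd size. *)
pose V (A : {set H}) := \sum_(e1 < e | #|A| == e1.*2.+1)
  ((e1.*2)`! * ((e - e1.+1).*2)`! * cut_sum e1 (e - e1.+1)).
transitivity (\sum_(a : H) \sum_(b : H)
    \sum_(A : {set H} | (a \in A) && (b \notin A)) V A).
  apply: eq_bigr => a _.
  rewrite (sum_trees_cut a (fun s => (#|porbit s.2 a| == d v) *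
     root_choices s.2 setT a (degs d K))).
  apply: eq_bigr => b _; apply: eq_bigr => A /andP[aA bA].
  have cAB : #|A| + #|~: A| = e.*2 by rewrite cardsC card_ord.
  have bB : b \in ~: A by rewrite inE.
  have B0 : 0 < #|~: A| by apply/card_gt0P; exists b.
  have [oA | eA] := boolP (odd #|A|); last first.
    rewrite big_pred0 => [|p]; last by apply: contraNF eA => /planted_odd.
    rewrite /V big_pred0 // => e1; apply: contraNF eA => /eqP->.
    by rewrite /= odd_double.
  have lt1 : #|A|./2 < e by lia.
  have cA : #|A| = (#|A|./2).*2.+1 by lia.
  rewrite (@sum_glued _ A a b #|A|./2 (e - (#|A|./2).+1)) //; last by lia.
  rewrite /V (big_pred1 (Ordinal lt1)) // => e1.
  by rewrite /= {1}cA eqSS (inj_eq double_inj) eq_sym.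
rewrite big_distrr /=.
(* For given A, there are #|A| choices of a and #|~: A| choices of b. *)
transitivity (\sum_(A : {set H}) (#|A| * #|~: A|) * V A).
  under eq_bigr => a _ do rewrite (exchange_big_dep predT) //=.
  rewrite exchange_big /=; apply: eq_bigr => A _.
  transitivity (\sum_(a in A) \sum_(b in ~: A) V A).
    rewrite [RHS]big_mkcond; apply: eq_bigr => a _.
    case: (a \in A); last by rewrite big_pred0.
    by apply: eq_bigl => b; rewrite inE.
  by rewrite !sum_nat_const mulnA.
transitivity (\sum_(A : {set H}) \sum_(e1 < e | #|A| == e1.*2.+1)
    #|A| * #|~: A| *
      ((e1.*2)`! * ((e - e1.+1).*2)`! * cut_sum e1 (e - e1.+1))).
  by apply: eq_bigr => A _; rewrite big_distrr.
rewrite (exchange_big_dep predT) //=; apply: eq_bigr => e1 _.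
have lt1 := ltn_ord e1; set e2 := e - e1.+1.
have eE : e.*2 = e1.*2.+1 + e2.*2.+1 by rewrite /e2; lia.
transitivity (\sum_(A : {set H} | #|A| == e1.*2.+1)
   (e1.*2.+1)`! * (e2.*2.+1)`! * cut_sum e1 e2).
  apply: eq_bigr => A /eqP cA.
  have cB : #|~: A| = e2.*2.+1.
    by apply/eqP; rewrite -(eqn_add2l #|A|) cardsC card_ord cA -eE.
  by rewrite cA cB !factS mulnA mulnACA.
rewrite sum_nat_const.
have -> : #|[pred A : {set H} | #|A| == e1.*2.+1]| = 'C(e.*2, e1.*2.+1).
  by rewrite -[in RHS](card_ord e.*2) -card_draws; apply: eq_card => A; rewrite !inE.
rewrite mulnA; congr (_ * _).
have le1 : e1.*2.+1 <= e.*2 by rewrite eE leq_addr.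
have -> : e2.*2.+1 = e.*2 - e1.*2.+1 by rewrite eE addKn.
exact: bin_fact.
Qed.

End Recursion.

Theorem theorem1 (N e : nat) (hN : 0 < N) (he : 0 < e) (d : 'I_N -> nat) :
  let v1 : 'I_N := Ordinal hN in
  let deg (i : 'I_N) : int := Posz (d i) in
  T N e [seq deg i | i <- enum 'I_N] =
  \sum_(e1 < e) \sum_(e2 < e | e1 + e2 == e - 1)
    ( \sum_(I : {set 'I_N})
      \sum_(J : {set 'I_N} | (I :|: J == [set~ v1]) && (I :&: J == set0))
        T (#|I| + 1) e1 ((deg v1 - 1)%R :: [seq deg i | i <- enum I]) *
        T (#|J| + 1) e2 [seq deg j | j <- enum J]
    + \sum_(r : 'I_N | r != v1) \sum_(I : {set 'I_N})
      \sum_(J : {set 'I_N} | (I :|: J == [set~ v1] :\ r) && (I :&: J == set0))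
        d r * T (#|I| + 1) e1 ((deg v1 - 1)%R :: [seq deg i | i <- enum I]) *
        T (#|J| + 1) e2 ((deg r - 1)%R :: [seq deg j | j <- enum J]) ).
Proof.
move=> v1 deg.
have enumE : enum 'I_N = v1 :: enum [set~ v1].
  have E : exists s, enum 'I_N = v1 :: s.
    case: N hN d @v1 @deg => // n hN _ v1 _; exists (map (lift ord0) (enum 'I_n)).
    by rewrite enum_ordSl; congr (_ :: _); apply: val_inj.
  have [s sE] := E; rewrite sE; congr (_ :: _).
  have := enum_uniq 'I_N; rewrite sE => /andP[v1s _].
  have -> : enum [set~ v1] = [seq i <- enum 'I_N | i \in [set~ v1]].
    by rewrite [in RHS]enumT.
  rewrite sE /= !inE eqxx /=; apply/esym/all_filterP/allP=> i si.
  by rewrite !inE; apply: contraNneq v1s => <-.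
rewrite enumE -{1}(card_ord N) (T_cut v1 d he); apply: eq_bigr => e1 _.
rewrite (big_pred1 (rev_ord e1)) // => e2; rewrite /= -val_eqE /=.
have := ltn_ord e1; have := ltn_ord e2; lia.
Qed.
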